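(* Consider the nonconvex-strongly-concave minimax problem with the standing assumptions and the one-epoch ($S=1$) full-shuffling variant of Algorithm 2 described in the context. Suppose in addition that, for the step sizes $\eta,\hat\eta$ used: (A) there are $\Lambda_0\ge1,\Lambda_1\ge0$ with $\|\nabla\Phi_0(w)\|^2\le\Lambda_0\|\mathcal{G}_\eta(w)\|^2+\Lambda_1$ for all $w$; (B) there are $\hat\Lambda_0\ge1,\hat\Lambda_1\ge0$ with $\|\nabla_u\mathcal{H}(w,u)\|^2\le\hat\Lambda_0\|\hat{\mathcal{G}}_{\hat\eta}(u)\|^2+\hat\Lambda_1$ for all $(w,u)\in\mathrm{dom}(\mathcal{L})$, where $\hat{\mathcal{G}}_{\hat\eta}(u):=\hat\eta^{-1}\big(u-\mathrm{prox}_{\hat\eta h}(u+\hat\eta\nabla_u\mathcal{H}(w,u))\big)$; (C) there is $L_f\ge0$ with $f(y)\le f(x)+\langle f'(x),y-x\rangle+\frac{L_f}2\|y-x\|^2$ for all $x,y\in\mathrm{dom}(f)$ and $f'(x)\in\partial f(x)$. Let $\kappa:=\frac{L_u}{\mu_H+\mu_h}$. Then there exist positive constants $c,C$ (independent of $\epsilon$ and $n$, depending only on $L_w,L_u,L_f,\mu_H,\mu_h,\Theta_w,\sigma_w,\Theta_u,\sigma_u,\Lambda_0,\Lambda_1,\hat\Lambda_0,\hat\Lambda_1$, $\Psi_0(\widetilde w_0)-\Psi_0^\star$ and $\Psi_0(\widetilde w_0)-\mathcal{L}(\widetilde w_0,\widetilde u_0)$) such that for every sufficiently small $\epsilon>0$: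 if $\{(\widetilde w_t,\widetilde u_t)\}$ is generated by this variant with fixed learning rates $\eta_t=\eta:=c\,\epsilon$, $\hat\eta_t=\hat\eta:=30\kappa^2\eta$, arbitrary permutations, and $T:=\lceil C\epsilon^{-3}\rceil$, then $$\frac1{T+1}\sum_{t=0}^T\|\mathcal{G}_\eta(\widetilde w_t)\|^2\le\epsilon^2 .$$ Consequently, the algorithm requires $\mathcal{O}(n\epsilon^{-3})$ evaluations of both $\nabla_w\mathcal{H}_i$ and $\nabla_u\mathcal{H}_i$ to achieve an $\epsilon$-stationary point $\widehat w_T$ of $\min_w\Psi_0(w)$, i.e. $\mathbb{E}[\|\mathcal{G}_\eta(\widehat w_T)\|^2]\le\epsilon^2$.
   Context: Problem: $\min_{w\in\mathbb{R}^p}\max_{u\in\mathbb{R}^q}\{\mathcal{L}(w,u):=f(w)+\mathcal{H}(w,u)-h(u)\}$, $\mathcal{H}:=\frac1n\sum_{i=1}^n\mathcal{H}_i$, with $\mathcal{H}_i:\mathbb{R}^p\times\mathbb{R}^q\to\mathbb{R}$ differentiable and $f,h$ proper, closed, convex with values in $\mathbb{R}\cup\{+\infty\}$. Assumptions: $h$ is $\mu_h$-strongly convex, $\mu_h\ge0$, with bounded domain. For each $i$: $\mathcal{H}_i(w,\cdot)$ is $\mu_H$-strongly concave for every $w$, $\mu_H\ge0$, and $\mu_H+\mu_h>0$; $\|\nabla\mathcal{H}_i(w,u)-\nabla\mathcal{H}_i(\hat w,\hat u)\|^2\le L_w^2\|w-\hat w\|^2+L_u^2\|u-\hat u\|^2$.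 There are $\Theta_w,\sigma_w,\Theta_u,\sigma_u\ge0$ with $\frac1n\sum_i\|\nabla_w\mathcal{H}_i-\nabla_w\mathcal{H}\|^2\le\Theta_w\|\nabla_w\mathcal{H}\|^2+\sigma_w^2$ and $\frac1n\sum_i\|\nabla_u\mathcal{H}_i-\nabla_u\mathcal{H}\|^2\le\Theta_u\|\nabla_u\mathcal{H}\|^2+\sigma_u^2$ at every $(w,u)$. $\Phi_0(w):=\max_u\{\mathcal{H}(w,u)-h(u)\}$ with unique maximizer $u_0^*(w)$, $\nabla\Phi_0(w)=\nabla_w\mathcal{H}(w,u_0^*(w))$, $\Psi_0:=f+\Phi_0$, $\Psi_0^\star:=\inf\Psi_0>-\infty$. Gradient mapping: $\mathcal{G}_\eta(w):=\eta^{-1}\big(w-\mathrm{prox}_{\eta f}(w-\eta\nabla\Phi_0(w))\big)$, where $\mathrm{prox}_{\eta f}(w)=\arg\min_v\{f(v)+\frac1{2\eta}\|v-w\|^2\}$. Algorithm 2 (full-shuffling variant, $S=1$): start from $(\widetilde w_0,\widetilde u_0)\in\mathrm{dom}(\mathcal{L})$. At epoch $t=1,\dots,T$: (1) generate a permutation $\pi^{(t)}$ of $\{1,\dots,n\}$, set $u_0^{(t)}:=\widetilde u_{t-1}$, for $i=1,\dots,n$ set $u_i^{(t)}:=u_{i-1}^{(t)}+\frac{\hat\eta_t}n\nabla_u\mathcal{H}_{\pi^{(t)}(i)}(\widetilde w_{t-1},u_{i-1}^{(t)})$, and set $\widetilde u_t:=\mathrm{prox}_{\hat\eta_th}(u_n^{(t)})$.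 (2) Set $w_0^{(t)}:=\widetilde w_{t-1}$, generate a permutation $\hat\pi^{(t)}$ of $\{1,\dots,n\}$; for $i=1,\dots,n$: $w_i^{(t)}:=w_{i-1}^{(t)}-\frac{\eta_t}n\nabla_w\mathcal{H}_{\hat\pi^{(t)}(i)}(w_{i-1}^{(t)},\widetilde u_t)$; set $\widetilde w_t:=\mathrm{prox}_{\eta_tf}(w_n^{(t)})$. Output: $\widehat w_T:=\widetilde w_{t_*}$, where either $t_*\in\arg\min_{0\le t\le T}\|\mathcal{G}_\eta(\widetilde w_t)\|$ or $t_*$ is uniformly random in $\{0,\dots,T\}$. *)

(* Defs.v *)
From HB Require Import structures.
From mathcomp Require Import all_boot all_order all_algebra perm.
From mathcomp Require Import all_classical all_reals all_analysis.

Set Implicit Arguments.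
Unset Strict Implicit.
Unset Printing Implicit Defensive.

Import Order.TTheory GRing.Theory Num.Theory.
Import numFieldNormedType.Exports.

Local Open Scope classical_set_scope.
Local Open Scope ring_scope.

Section Euclidean.
Variable R : realType.

Definition dotv m (x y : 'rV[R]_m) : R := \sum_(j < m) x 0 j * y 0 j.

(* The library norm on 'rV[R]_m is the sup norm; [enorm] is the Euclidean
   one.  Both induce the same topology, so that [closed], [bounded_set] and
   [differentiable] below keep their usual meaning. *)
Definition enorm m (x : 'rV[R]_m) : R := Num.sqrt (dotv x x).

Definition grad m (F : 'rV[R]_m -> R) (x : 'rV[R]_m) : 'rV[R]_m :=
  \row_j 'D_(delta_mx 0 j) F x.

End Euclidean.

Section ConvexFunctions.
Variables (R : realType) (m : nat).
Implicit Types f : 'rV[R]_m -> \bar R.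

Definition edom f : set 'rV[R]_m := [set x | (f x < +oo)%E].

Definition proper f := (forall x, (-oo < f x)%E) /\ edom f !=set0.

Definition closed_fun f :=
  closed [set z : 'rV[R]_m * R | (f z.1 <= z.2%:E)%E].

(* Only used for functions that never take the value -oo; 0 * +oo = 0. *)
Definition convex_fun f := forall (x y : 'rV[R]_m) (t : R), 0 <= t <= 1 ->
  (f (t *: x + (1 - t) *: y)%R <= t%:E * f x + (1 - t)%:E * f y)%E.

(* mu = 0 is plain convexity. *)
Definition strongly_convex (mu : R) f :=
  convex_fun (fun x => f x - (mu / 2 * enorm x ^+ 2)%:E)%E.

Definition subdiff f (x : 'rV[R]_m) : set 'rV[R]_m :=
  [set g | forall y, (f x + (dotv g (y - x))%:E <= f y)%E].

(* For eta > 0 and f proper, closed and convex the minimizer exists and is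
   unique, so that the default value 0 is never taken. *)
Definition prox (eta : R) f (x : 'rV[R]_m) : 'rV[R]_m :=
  let F v := (f v + ((2 * eta)^-1 * enorm (v - x) ^+ 2)%:E)%E in
  xget 0 [set v | forall z, (F v <= F z)%E].

End ConvexFunctions.

Section Minimax.
Variables (R : realType) (n p q : nat).

Record minimax := Minimax {
  pf : 'rV[R]_p -> \bar R;
  ph : 'rV[R]_q -> \bar R;
  pH : 'I_n -> 'rV[R]_p -> 'rV[R]_q -> R
}.

Implicit Types (P : minimax) (w : 'rV[R]_p) (u : 'rV[R]_q).

Definition avgH P w u : R := n%:R^-1 * \sum_(i < n) pH P i w u.

Definition gradw (K : 'rV[R]_p -> 'rV[R]_q -> R) w u : 'rV[R]_p :=
  grad (fun w' => K w' u) w.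

Definition gradu (K : 'rV[R]_p -> 'rV[R]_q -> R) w u : 'rV[R]_q :=
  grad (fun u' => K w u') u.

Definition gradwu (K : 'rV[R]_p -> 'rV[R]_q -> R) w u : 'rV[R]_(p + q) :=
  row_mx (gradw K w u) (gradu K w u).

Definition Lagr P w u : \bar R := (pf P w + (avgH P w u)%:E - ph P u)%E.

Definition domL P w u := edom (pf P) w /\ edom (ph P) u.

(* Under [standing] the supremum is finite and attained at a unique point. *)
Definition Phi0 P w : R :=
  fine (ereal_sup (range (fun u => ((avgH P w u)%:E - ph P u)%E))).

Definition Psi0 P w : \bar R := (pf P w + (Phi0 P w)%:E)%E.

Definition Psi0star P : \bar R := ereal_inf (range (Psi0 P)).

Definition gradmap P (eta : R) w : 'rV[R]_p :=
  eta^-1 *: (w - prox eta (pf P) (w - eta *: grad (Phi0 P) w)).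

Definition gradmapu P (etah : R) w u : 'rV[R]_q :=
  etah^-1 *: (u - prox etah (ph P) (u + etah *: gradu (avgH P) w u)).

Record standing P (Lw Lu muH muh Thetaw sigmaw Thetau sigmau : R) : Prop :=
  Standing {
  std_f : [/\ proper (pf P), closed_fun (pf P) & convex_fun (pf P)];
  std_h : [/\ proper (ph P), closed_fun (ph P) & convex_fun (ph P)];
  std_h_strong : strongly_convex muh (ph P);
  std_h_bounded : bounded_set (edom (ph P));
  std_H_diff : forall i (z : 'rV[R]_p * 'rV[R]_q),
    differentiable (fun z' : 'rV[R]_p * 'rV[R]_q => pH P i z'.1 z'.2) z;
  std_H_concave : forall i w,
    strongly_convex muH (fun u => (- pH P i w u)%:E);
  std_H_smooth : forall i w w' u u',
    enorm (gradwu (pH P i) w u - gradwu (pH P i) w' u') ^+ 2 <=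
    Lw ^+ 2 * enorm (w - w') ^+ 2 + Lu ^+ 2 * enorm (u - u') ^+ 2;
  std_var_w : forall w u,
    n%:R^-1 * \sum_(i < n)
      enorm (gradw (pH P i) w u - gradw (avgH P) w u) ^+ 2 <=
    Thetaw * enorm (gradw (avgH P) w u) ^+ 2 + sigmaw ^+ 2;
  std_var_u : forall w u,
    n%:R^-1 * \sum_(i < n)
      enorm (gradu (pH P i) w u - gradu (avgH P) w u) ^+ 2 <=
    Thetau * enorm (gradu (avgH P) w u) ^+ 2 + sigmau ^+ 2;
  std_Psi0star : (-oo < Psi0star P)%E
}.

Definition condA P (eta Lam0 Lam1 : R) := forall w,
  enorm (grad (Phi0 P) w) ^+ 2 <= Lam0 * enorm (gradmap P eta w) ^+ 2 + Lam1.

Definition condB P (etah Lamh0 Lamh1 : R) := forall w u, domL P w u ->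
  enorm (gradu (avgH P) w u) ^+ 2 <=
  Lamh0 * enorm (gradmapu P etah w u) ^+ 2 + Lamh1.

Definition condC P (Lf : R) := forall x y g,
  edom (pf P) x -> edom (pf P) y -> subdiff (pf P) x g ->
  (pf P y <= pf P x + (dotv g (y - x) + Lf / 2 * enorm (y - x) ^+ 2)%:E)%E.

(* One shuffled pass x <- x + a *: g (s i) x over i = 0, ..., n - 1; the second
   component counts the evaluations of the component maps g. *)
Definition pass m (a : R) (g : 'I_n -> 'rV[R]_m -> 'rV[R]_m) (s : 'S_n)
    (x : 'rV[R]_m) : 'rV[R]_m * nat :=
  foldl (fun y i => (y.1 + a *: g (s i) y.1, y.2.+1)) (x, 0%N) (enum 'I_n).

Record alg_state := AlgState {
  st_w : 'rV[R]_p;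
  st_u : 'rV[R]_q;
  st_nw : nat;
  st_nu : nat
}.

Definition epoch P (eta etah : R) (pi pih : 'S_n) (s : alg_state) : alg_state :=
  let pu := pass (etah / n%:R) (fun i u => gradu (pH P i) (st_w s) u)
              pi (st_u s) in
  let u' := prox etah (ph P) pu.1 in
  let pw := pass (- (eta / n%:R)) (fun i w => gradw (pH P i) w u')
              pih (st_w s) in
  AlgState (prox eta (pf P) pw.1) u' (st_nw s + pw.2) (st_nu s + pu.2).

(* State after t epochs; epoch k (k >= 1) uses eta k, etah k, pi k, pih k. *)
Fixpoint alg P (eta etah : nat -> R) (pi pih : nat -> 'S_n)
    (w0 : 'rV[R]_p) (u0 : 'rV[R]_q) (t : nat) : alg_state :=
  if t is k.+1 then
    epoch P (eta k.+1) (etah k.+1) (pi k.+1) (pih k.+1)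
      (alg P eta etah pi pih w0 u0 k)
  else AlgState w0 u0 0 0.

End Minimax.

Section Output.
Local Open Scope ereal_scope.
Variables (R : realType) (d : measure_display) (Omega : measurableType d).
Variable Pr : probability Omega R.

Definition discrete_rv (A : Type) (X : Omega -> A) :=
  forall a, measurable [set o | X o = a].

Definition argmin_output T (g : Omega -> nat -> R) (ts : Omega -> 'I_T.+1) :=
  forall o (t : 'I_T.+1), (g o (ts o) <= g o t)%R.

(* The index is uniform on {0, ..., T}, drawn independently of the
   permutations used in epochs 1, ..., T. *)
Definition uniform_output n T (pi pih : nat -> Omega -> 'S_n)
    (ts : Omega -> 'I_T.+1) :=
  (forall t, Pr [set o | ts o = t] = (T.+1%:R^-1)%:E) /\
  (forall (s sh : nat -> 'S_n) (t : 'I_T.+1),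
    let E := [set o | forall k, (1 <= k <= T)%N ->
                        pi k o = s k /\ pih k o = sh k] in
    Pr (E `&` [set o | ts o = t]) = Pr E * Pr [set o | ts o = t]).

End Output.

(* Main.v *)
(** Write [u*(w)] for the maximizer of [H w - h] and [mu = muH + muh].  Quadratic
    growth at [u*(w)], together with the fact that [H w u - H w u'] is Lipschitz in
    [w] with constant [Lu |u - u'|], makes [u*] Lipschitz with constant
    [kappa = Lu / mu], and squeezes [Phi0] between two quadratics that touch it with
    slope [gradw w (u* w)].

    One epoch is an inexact proximal gradient step in each variable.  A pass with
    step [a] evaluates the component gradients up to an error [O(a)] times their mean
    norm, which the variance bounds and (A), (B) control by the gradient mappings, up
    to constants.  With [d = |u - u*(w)|^2] the ascent pass contracts [d] by
    [1 - O(etah mu)], while the descent pass decreases [Psi0] by a multiple of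
    [|w' - w|^2 / eta] up to [O(eta Lu^2 d)] and increases [d] by at most
    [O(kappa^2 |w' - w|^2 / (etah mu))].  Since [etah = 30 kappa^2 eta] and
    [Lu = kappa mu], these cross terms balance in the potential [Psi0 + mu/2 d], so
    that an epoch decreases it by at least [eta/16 |G|^2 - O(eta^3)]; summing over
    the epochs gives the rate. *)

Require Import Defs.
From mathcomp Require Import all_boot all_order all_algebra perm.
From mathcomp Require Import all_classical all_reals all_analysis.
From mathcomp Require Import ring lra measurable_realfun.
Import Order.TTheory GRing.Theory Num.Theory.
Import numFieldNormedType.Exports.

Set Implicit Arguments.
Unset Strict Implicit.
Unset Printing Implicit Defensive.

Local Open Scope classical_set_scope.
Local Open Scope ring_scope.

(** * Euclidean norm *)

Section EuclideanSpace.
Variables (R : realType) (m : nat).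
Implicit Types (x y z : 'rV[R]_m) (a : R).

Lemma dotvC x y : dotv x y = dotv y x.
Proof. by apply: eq_bigr => j _; rewrite mulrC. Qed.

Lemma dotvDl x y z : dotv (x + y) z = dotv x z + dotv y z.
Proof.
by rewrite /dotv -big_split; apply: eq_bigr => j _; rewrite mxE mulrDl.
Qed.

Lemma dotvZl a x z : dotv (a *: x) z = a * dotv x z.
Proof. by rewrite /dotv big_distrr /=; apply: eq_bigr => j _; rewrite mxE mulrA. Qed.

Lemma dotvDr x y z : dotv z (x + y) = dotv z x + dotv z y.
Proof. by rewrite dotvC dotvDl !(dotvC z). Qed.

Lemma dotvZr a x z : dotv z (a *: x) = a * dotv z x.
Proof. by rewrite dotvC dotvZl (dotvC z). Qed.

Lemma dotvNl x z : dotv (- x) z = - dotv x z.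
Proof. by rewrite -scaleN1r dotvZl mulN1r. Qed.

Lemma dotvNr x z : dotv z (- x) = - dotv z x.
Proof. by rewrite dotvC dotvNl (dotvC z). Qed.

Definition dotvE := (dotvDl, dotvDr, dotvNl, dotvNr, dotvZl, dotvZr).

Lemma dotv_ge0 x : 0 <= dotv x x.
Proof. by apply: sumr_ge0 => j _; rewrite -expr2 sqr_ge0. Qed.

Lemma enorm_sqr x : enorm x ^+ 2 = dotv x x.
Proof. by rewrite /enorm sqr_sqrtr // dotv_ge0. Qed.

Lemma enorm_ge0 x : 0 <= enorm x.
Proof. exact: sqrtr_ge0. Qed.

Lemma enorm0 : enorm (0 : 'rV[R]_m) = 0.
Proof. by rewrite /enorm -(scale0r 0) dotvZl mul0r sqrtr0. Qed.

Lemma enormZ a x : enorm (a *: x) = `|a| * enorm x.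
Proof.
by rewrite /enorm dotvZl dotvZr mulrA -expr2 sqrtrM ?sqr_ge0 // sqrtr_sqr.
Qed.

Lemma enormN x : enorm (- x) = enorm x.
Proof. by rewrite -scaleN1r enormZ normrN1 mul1r. Qed.

Lemma enormB x y : enorm (x - y) = enorm (y - x).
Proof. by rewrite -enormN opprB. Qed.

Lemma cauchy_schwarz x y : dotv x y <= enorm x * enorm y.
Proof.
have [x0|x0] := eqVneq (enorm x) 0; last first.
  have xp : 0 < enorm x by rewrite lt0r x0 enorm_ge0.
  have [y0|y0] := eqVneq (enorm y) 0; last first.
    have yp : 0 < enorm y by rewrite lt0r y0 enorm_ge0.
    have := dotv_ge0 (enorm y *: x - enorm x *: y).
    rewrite !dotvE (dotvC y x) -!enorm_sqr => h.
    have {}h : 0 <= (enorm x * enorm y) * (enorm x * enorm y - dotv x y) by lra.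
    by move: h; rewrite pmulr_rge0 ?mulr_gt0 // subr_ge0.
  rewrite y0 mulr0; apply: contrapT => /negP; rewrite -ltNge => h.
  (* When [enorm y = 0] this multiplier turns the square into [|x|^2 - 2 (|x|^2 + 1)], which is
     negative, so a positive [dotv x y] is impossible. *)
  have := dotv_ge0 (x - (((enorm x ^+ 2 + 1) / dotv x y) *: y)).
  rewrite !dotvE (dotvC y x) -!enorm_sqr y0 divfK ?gt_eqF //; nra.
rewrite x0 mul0r; apply: contrapT => /negP; rewrite -ltNge => h.
have := dotv_ge0 (y - (((enorm y ^+ 2 + 1) / dotv x y) *: x)).
rewrite !dotvE (dotvC y x) -!enorm_sqr x0 divfK ?gt_eqF //; nra.
Qed.

Lemma cauchy_schwarz_norm x y : `|dotv x y| <= enorm x * enorm y.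
Proof.
rewrite ler_norml cauchy_schwarz andbT lerNl -dotvNl.
by rewrite -(enormN x) cauchy_schwarz.
Qed.

Lemma enormD x y : enorm (x + y) <= enorm x + enorm y.
Proof.
rewrite -(@ler_pXn2r _ 2) ?nnegrE ?addr_ge0 ?enorm_ge0 //.
rewrite enorm_sqr !dotvE (dotvC y x) sqrrD !enorm_sqr.
by have := cauchy_schwarz x y; lra.
Qed.

Lemma enorm_sum (I : Type) (r : seq I) (F : I -> 'rV[R]_m) :
  enorm (\sum_(i <- r) F i) <= \sum_(i <- r) enorm (F i).
Proof.
elim/big_ind2: _ => [|x a y b xa yb|i _]; first by rewrite enorm0.
  by apply: le_trans (enormD _ _) _; exact: lerD.
exact: lexx.
Qed.

(** Young's inequality: a weight proportional to the step size costs a contraction little and puts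
    the large factor on the error [y]. *)
Lemma enormD_sqr_weighted a x y : 0 < a ->
  enorm (x + y) ^+ 2 <= (1 + a) * enorm x ^+ 2 + (1 + a^-1) * enorm y ^+ 2.
Proof.
move=> a0.
apply: (@le_trans _ _ ((enorm x + enorm y) ^+ 2)).
  by rewrite ler_pXn2r ?nnegrE ?addr_ge0 ?enorm_ge0 // enormD.
have -> : (1 + a) * enorm x ^+ 2 + (1 + a^-1) * enorm y ^+ 2 =
   (enorm x + enorm y) ^+ 2 + a^-1 * (a * enorm x - enorm y) ^+ 2.
  by field; rewrite gt_eqF.
by rewrite lerDl mulr_ge0 ?invr_ge0 ?sqr_ge0 // ltW.
Qed.

Lemma enormD_sqr x y :
  enorm (x + y) ^+ 2 <= 2 * enorm x ^+ 2 + 2 * enorm y ^+ 2.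
Proof. by have := enormD_sqr_weighted x y ltr01; rewrite invr1. Qed.

Lemma enormB_sqr x y :
  enorm (x - y) ^+ 2 = enorm x ^+ 2 - 2 * dotv x y + enorm y ^+ 2.
Proof. by rewrite !enorm_sqr !dotvE (dotvC y x); ring. Qed.

Lemma mx_norm_le_enorm x : `|x| <= enorm x.
Proof.
rewrite /Num.norm/= mx_normrE; apply: bigmax_le => [|[i j] _ /=].
  exact: enorm_ge0.
rewrite (ord1 i) -(@ler_pXn2r _ 2) ?nnegrE ?enorm_ge0 // enorm_sqr.
rewrite /dotv (bigD1 j) //= real_normK ?num_real // expr2 lerDl.
by apply: sumr_ge0 => k _; rewrite -expr2 sqr_ge0.
Qed.

End EuclideanSpace.

(** * Gradients and strong convexity *)

Section Gradient.
Variables (R : realType) (m : nat).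
Implicit Types (F : 'rV[R]_m -> R) (x d : 'rV[R]_m).

Lemma derive_dotv F x d : differentiable F x -> 'D_d F x = dotv (grad F x) d.
Proof.
move=> dF; rewrite deriveE // {1}(row_sum_delta d) linear_sum /dotv.
by apply: eq_bigr => j _; rewrite linearZ /= mxE deriveE // mulrC.
Qed.

Lemma is_derive_line F x d (t : R) : differentiable F (x + t *: d) ->
  is_derive t 1 (fun s : R => F (x + s *: d)) (dotv (grad F (x + t *: d)) d).
Proof.
move=> dF.
have E (h : R) : F (x + (h *: (1 : R) + t) *: d) = F (h *: d + (x + t *: d)).
  by rewrite [h *: (1 : R)]mulr1 scalerDl addrCA.
apply: DeriveDef.
  apply/derivable1P.
  have /derivable1P : derivable F (x + t *: d) d by exact: diff_derivable.
  by under [X in _ -> derivable X _ _]eq_fun do rewrite E.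
rewrite -derive_dotv //; rewrite /derive.
by under [X in lim (X @ _) = _]eq_fun do rewrite /= E.
Qed.

Lemma mean_value F x d : (forall y, differentiable F y) ->
  exists2 t : R, 0 <= t <= 1 & F (x + d) - F x = dotv (grad F (x + t *: d)) d.
Proof.
move=> dF.
have [||t t01] := @MVT_segment R (fun s => F (x + s *: d))
  (fun s => dotv (grad F (x + s *: d)) d) 0 1 ler01.
- by move=> t _; exact: is_derive_line.
- apply: continuous_subspaceT => t; apply: differentiable_continuous.
  by apply/derivable1_diffP; have [] := is_derive_line (dF (x + t *: d)).
rewrite scale1r scale0r addr0 subr0 mulr1 => h; exists t => //.
Qed.

(** The mean value theorem replaces integration along the segment, whence the constant [L] and not
    the sharp [L / 2]. *)
Lemma lipschitz_grad_taylor F (L : R) : (forall y, differentiable F y) ->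
  0 <= L -> (forall x y, enorm (grad F x - grad F y) <= L * enorm (x - y)) ->
  forall x d, `|F (x + d) - F x - dotv (grad F x) d| <= L * enorm d ^+ 2.
Proof.
move=> dF L0 lipF x d; have [t /andP[t0 t1] ->] := mean_value x d dF.
rewrite -dotvNl -dotvDl; apply: le_trans (cauchy_schwarz_norm _ _) _.
rewrite expr2 mulrA; apply: ler_wpM2r; first exact: enorm_ge0.
apply: le_trans (lipF _ _) _; apply: ler_wpM2l => //.
by rewrite addrAC subrr add0r enormZ ger0_norm // ler_piMl // enorm_ge0.
Qed.

(** A quadratic remainder fixes every partial derivative without assuming differentiability; this
    computes the gradients of [avgH] and [Phi0]. *)
Lemma grad_unique F x (g : 'rV[R]_m) (K : R) :
  (forall d, `|F (x + d) - F x - dotv g d| <= K * enorm d ^+ 2) ->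
  grad F x = g.
Proof.
move=> hF; apply/rowP => j; rewrite mxE; set v := delta_mx 0 j.
have -> : g 0 j = dotv g v.
  rewrite /dotv (bigD1 j) //= big1 ?addr0 ?mxE ?eqxx ?mulr1 // => k kj.
  by rewrite mxE (negPf kj) mulr0.
apply: cvg_lim => //; apply/cvgrPdist_le => e e0.
pose M := `|K| * enorm v ^+ 2 + 1.
have M0 : 0 < M by rewrite ltr_wpDl // mulr_ge0 ?sqr_ge0.
near=> h.
have h0 : h != 0 by near: h; exact: nbhs_dnbhs_neq.
have hs : `|h| <= e / M.
  near: h; apply: dnbhs0_le; exact: divr_gt0.
rewrite distrC /= (addrC _ x).
have -> : h^-1 *: (F (x + h *: v) - F x) - dotv g v =
    h^-1 * (F (x + h *: v) - F x - dotv g (h *: v)).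
  by rewrite dotvZr mulrBr mulrA mulVf // mul1r.
rewrite normrM normfV ler_pdivrMl ?normr_gt0 //.
apply: le_trans (hF _) _; rewrite enormZ exprMn real_normK ?num_real //.
rewrite -[h ^+ 2]real_normK ?num_real // mulrCA [`|h| ^+ 2]expr2 -mulrA.
apply: ler_wpM2l => //; apply: (@le_trans _ _ (`|h| * M)).
  apply: ler_wpM2l => //; rewrite /M.
  apply: (@le_trans _ _ (`|K| * enorm v ^+ 2)); last by lra.
  by apply: ler_wpM2r; rewrite ?sqr_ge0 // ler_norm.
by rewrite -ler_pdivlMr.
Unshelve. all: by end_near. Qed.

End Gradient.

(** * Strong convexity of extended-valued functions *)

Section StrongConvexity.
Variables (R : realType) (m : nat).
Implicit Types (f : 'rV[R]_m -> \bar R) (g : 'rV[R]_m -> R) (x y z : 'rV[R]_m).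

(** Only the endpoints need finite values, named [a] and [b], so the right-hand side is plain real
    arithmetic. *)
Definition sconvex (mu : R) f := forall x y (a b t : R), 0 <= t <= 1 ->
  f x = a%:E -> f y = b%:E ->
  (f (t *: x + (1 - t) *: y)%R <=
   (t * a + (1 - t) * b - mu / 2 * (t * (1 - t)) * enorm (x - y) ^+ 2)%:E)%E.

Lemma enorm_sqr_conv (t : R) x y :
  enorm (t *: x + (1 - t) *: y) ^+ 2 =
  t * enorm x ^+ 2 + (1 - t) * enorm y ^+ 2 - t * (1 - t) * enorm (x - y) ^+ 2.
Proof. by rewrite !enorm_sqr !dotvE (dotvC y x); ring. Qed.

Lemma strongly_convex_sconvex (mu : R) f : strongly_convex mu f -> sconvex mu f.
Proof.
move=> cf x y a b t t01 fx fy; have := cf x y t t01; rewrite fx fy.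
rewrite enorm_sqr_conv.
case: (f _) => [r| |]; rewrite ?leNye //=.
rewrite -!EFinM -!EFinD !lee_fin; lra.
Qed.

Lemma convex_sconvex f : convex_fun f -> sconvex 0 f.
Proof.
move=> cf; apply: strongly_convex_sconvex; congr (convex_fun _): cf.
by apply/funext => x; rewrite !mul0r sube0.
Qed.

Lemma sconvexD (mu nu : R) f g : sconvex mu f -> sconvex nu (fun x => (g x)%:E) ->
  sconvex (mu + nu) (fun x => f x + (g x)%:E)%E.
Proof.
move=> cf cg x y a b t t01 fx fy.
have {}fx : f x = (a - g x)%:E.
  by move: fx; case: (f x) => // r [<-]; rewrite addrK.
have {}fy : f y = (b - g y)%:E.
  by move: fy; case: (f y) => // r [<-]; rewrite addrK.
have := cg x y _ _ t t01 erefl erefl; rewrite lee_fin => h.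
have := cf x y _ _ t t01 fx fy; case: (f _) => [r| |]; rewrite ?leNye //=.
by rewrite !lee_fin; lra.
Qed.

Lemma sconvex_dist_sqr (c : R) z :
  sconvex c (fun x => (c / 2 * enorm (x - z) ^+ 2)%:E).
Proof.
move=> x y a b t t01 [<-] [<-]; rewrite lee_fin.
have -> : t *: x + (1 - t) *: y - z = t *: (x - z) + (1 - t) *: (y - z).
  by rewrite !scalerBr addrACA -opprD -scalerDl addrC subrKC scale1r addrC.
rewrite enorm_sqr_conv; have -> : x - z - (y - z) = x - y by rewrite opprB addrA subrK.
lra.
Qed.

(** Stands for letting [t] tend to 0 after dividing a convexity inequality by [t]. *)
Lemma ler_of_small (a b : R) : (forall t, 0 < t -> t <= 1 -> a <= t * b) -> a <= 0.
Proof.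
move=> h; rewrite leNgt; apply/negP => a0.
have b0 : 0 < b by have := h 1 ltr01 (lexx 1); lra.
(* For this [t] the product [t * b] is at most [a / 2]. *)
pose t := a / (a + b) / 2.
have ab : 0 < a + b by lra.
have t1 : a / (a + b) <= 1 by rewrite ler_pdivrMr //; lra.
have t0 : 0 < a / (a + b) by exact: divr_gt0.
have := h t; have -> : t * b = a * (b / (a + b) / 2) by rewrite /t; field; lra.
have : b / (a + b) <= 1 by rewrite ler_pdivrMr //; lra.
rewrite /t; nra.
Qed.

(** Minimality is tested at [t *: y + (1 - t) *: x]; dividing by [t] and sending [t] to 0 leaves the
    quadratic gap. *)
Lemma sconvex_growth (mu : R) f x y (a b : R) : sconvex mu f ->
  (forall z, (f x <= f z)%E) -> f x = a%:E -> f y = b%:E ->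
  a + mu / 2 * enorm (y - x) ^+ 2 <= b.
Proof.
move=> cf fmin fx fy; set s := enorm _ ^+ 2.
rewrite -subr_le0; apply: (@ler_of_small _ (mu / 2 * s)) => t t0 t1.
have t01 : 0 <= t <= 1 by rewrite (ltW t0).
have := le_trans (fmin _) (cf y x b a t t01 fy fx).
rewrite fx lee_fin -/s => h.
have : t * (a + mu / 2 * s - b) <= t * (t * (mu / 2 * s)) by lra.
by rewrite ler_pM2l.
Qed.

(** Concavity bounds [g (x + t *: d)] below, and the Taylor remainder, of order [t ^+ 2], bounds it
    above; divide by [t] and let [t] vanish. *)
Lemma sconcave_grad (mu L : R) g :
  sconvex mu (fun x => (- g x)%:E) ->
  (forall x d, `|g (x + d) - g x - dotv (grad g x) d| <= L * enorm d ^+ 2) ->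
  forall x d, g (x + d) <= g x + dotv (grad g x) d - mu / 2 * enorm d ^+ 2.
Proof.
move=> cg tg x d; set s := enorm d ^+ 2; set gd := dotv _ _.
rewrite -subr_le0.
apply: (@ler_of_small _ ((L + mu / 2) * s)) => t t0 t1.
have t01 : 0 <= t <= 1 by rewrite (ltW t0).
have := cg (x + d) x _ _ t t01 erefl erefl; rewrite lee_fin.
have -> : t *: (x + d) + (1 - t) *: x = x + t *: d.
  by rewrite scalerDr addrAC -scalerDl addrC subrKC scale1r addrC.
have := tg x (t *: d); rewrite dotvZr -/gd enormZ exprMn (ger0_norm (ltW t0)).
have -> : x + d - x = d by rewrite addrAC subrr add0r.
rewrite -/s ler_norml => /andP[_ h1] h2.
rewrite -(ler_pM2l t0); lra.
Qed.

End StrongConvexity.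

(** * Proximal maps *)

Section Minimizers.
Variables (R : realType) (m : nat).
Implicit Types (f : 'rV[R]_m -> \bar R) (g : 'rV[R]_m -> R) (x y z : 'rV[R]_m).

Lemma continuous_enorm_sqr z : continuous (fun x => enorm (x - z) ^+ 2).
Proof.
move=> x; rewrite (_ : (fun _ => _) =
  \sum_(j < m) (fun x => (x 0 j - z 0 j) * (x 0 j - z 0 j))); last first.
  apply/funext => y; rewrite enorm_sqr /dotv fct_sumE.
  by apply: eq_bigr => j _; rewrite !mxE.
elim/big_ind: _ => [|F G cF cG|j _]; first exact: (@cst_continuous _ _ (0 : R)).
  exact: (@continuousD R R^o).
have c1 : {for x, continuous (fun y : 'rV[R]_m => y 0 j - z 0 j)}.
  by apply: (@continuousB R R^o); [exact: coord_continuous|exact: cst_continuous].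
exact: (continuousM c1 c1).
Qed.

Lemma closed_sublevel f g (r : R) : closed_fun f -> continuous g ->
  closed [set x | (f x + (g x)%:E <= r%:E)%E].
Proof.
move=> cf cg.
have -> : [set x | (f x + (g x)%:E <= r%:E)%E] =
    (fun x => (x, r - g x)) @^-1` [set z | (f z.1 <= z.2%:E)%E].
  by apply/seteqP; split => x /=; rewrite EFinB leeBrDr.
apply: preimage_closed => // x _.
have c2 : {for x, continuous (fun x => r - g x)}.
  by apply: (@continuousB R R^o); [exact: cst_continuous|exact: cg].
exact: (cvg_pair (@cvg_id _ (nbhs x)) c2).
Qed.

(** The nonempty sublevel sets within [K] form a filter base; a cluster point in [K] lies in each of
    them, since sublevel sets are closed. *)
Lemma compact_minimizer f g (K : set 'rV[R]_m) x0 :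
  closed_fun f -> continuous g -> compact K -> K x0 -> (f x0 < +oo)%E ->
  (forall x, -oo < f x)%E ->
  exists2 x, K x & forall y, K y -> (f x + (g x)%:E <= f y + (g y)%:E)%E.
Proof.
move=> cf cg cK Kx0 fx0 fNy; pose F x := (f x + (g x)%:E)%E.
pose B (r : R) := K `&` [set x | (F x <= r%:E)%E].
pose D := [set r : R | B r !=set0].
have DF y r : K y -> F y = r%:E -> D r by exists y; split => //=; rewrite H0.
have FF : Filter (filter_from D B).
  apply: filter_from_filter.
    exists (fine (f x0) + g x0); apply: (DF x0) => //.
    by rewrite /F -[f x0]fineK // fin_numElt fNy.
  move=> r s Dr Ds; exists (Order.min r s).
    by rewrite /Order.min; case: ifP.
  move=> x [Kx /= Fx]; split; split => //=; apply: le_trans Fx _;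
    by rewrite lee_fin ge_min lexx ?orbT.
have PF : ProperFilter (filter_from D B) by exact: filter_from_proper.
have [|x [Kx clx]] := cK _ PF.
  have [y _ [Ky]] : exists2 y, True & K y /\ F y = (fine (f x0) + g x0)%:E.
    exists x0 => //; split => //.
    by rewrite /F -[f x0]fineK // fin_numElt fNy.
  by move=> /(DF _ _ Ky) Dy; exists (fine (f x0) + g x0) => // z [].
exists x => // y Ky; rewrite -/(F x) -/(F y).
case Fy : (F y) => [r| |]; last 2 first.
- exact: leey.
- by move: Fy (fNy y); rewrite /F; case: (f y).
move: clx; rewrite clusterE => /(_ (B r)) h.
have : closure (B r) x by apply: h; exists r => //; exact: DF Fy.
have : closed [set x | (F x <= r%:E)%E] by exact: closed_sublevel.
by move=> clF Bx; apply: clF; apply: closureS Bx => z [].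
Qed.

Lemma compact_ball x (r : R) : compact [set y | `|y - x| <= r].
Proof.
apply: bounded_closed_compact.
  exists (r + `|x|); split; rewrite ?num_real // => s rs y /= yr.
  rewrite -(subrK x y); apply: le_trans (ler_normD _ _) _.
  by apply: le_trans (ltW rs); rewrite lerD2r.
have := @closed_closed_ball_ R _ x r; congr closed.
by apply/funext => y; rewrite /closed_ball_ /= distrC.
Qed.

(** A convex function falls at most linearly away from [x0], so the quadratic term wins outside a
    large ball, and the minimum over that compact ball is global. *)
Lemma prox_exists (eta : R) f x : 0 < eta -> Defs.proper f -> closed_fun f ->
  convex_fun f ->
  exists v, forall z, (f v + ((2 * eta)^-1 * enorm (v - x) ^+ 2)%:E <=
                       f z + ((2 * eta)^-1 * enorm (z - x) ^+ 2)%:E)%E.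
Proof.
move=> eta0 [fNy [x0 fx0]] cf /convex_sconvex cvf.
have fE y : (f y < +oo)%E -> f y = (fine (f y))%:E.
  by move=> fy; rewrite fineK // fin_numElt fNy.
pose q y := (2 * eta)^-1 * enorm (y - x) ^+ 2.
have cq : continuous q.
  move=> y; have c1 : {for y, continuous (fun=> (2 * eta)^-1)} by exact: cst_continuous.
  exact: (continuousM c1 (@continuous_enorm_sqr x y)).
have [||xm Kxm minxm] := @compact_minimizer f (fun=> 0) _ x0 cf _
    (@compact_ball x0 1) _ fx0 fNy.
- exact: cst_continuous.
- by rewrite /= subrr normr0.
set a := fine (f x0) in fE *; have fa : f x0 = a%:E := fE _ fx0.
have := minxm x0; rewrite /= subrr normr0 ler01 !adde0 fa => /(_ isT) fm.
have fb := fE xm (le_lt_trans fm (ltry _)); set b := fine (f xm) in fb.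
have ba : b <= a by move: fm; rewrite fb lee_fin.
pose r y := `|y - x0|; pose rho := `|x - x0|.
(* Convexity on the segment from [x0] to [y], at its point at distance 1 from [x0], where [f] is at
   least [b]. *)
have low y c : f y = c%:E -> 1 <= r y -> a - r y * (a - b) <= c.
  move=> fy r1; have r0 : 0 < r y by lra.
  have t01 : 0 <= (r y)^-1 <= 1 by rewrite invr_ge0 (ltW r0) invf_le1.
  have := cvf y x0 c a _ t01 fy fa.
  set z := _ + _; rewrite mul0r mul0r mul0r subr0 => fz.
  have : (f xm <= f z)%E.
    have := minxm z; rewrite !adde0; apply => /=.
    have -> : z - x0 = (r y)^-1 *: (y - x0).
      by rewrite /z scalerBl scale1r scalerBr addrA addrAC addrK.
    by rewrite normrZ gtr0_norm ?invr_gt0 // mulVf // gt_eqF.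
  move=> /le_trans/(_ fz); rewrite fb lee_fin.
  rewrite -(ler_pM2l r0) mulrDr !mulrA mulfV ?gt_eqF // mulrBr mulr1 mulfV ?gt_eqF //.
  lra.
(* Beyond radius [M], [(r - rho)^2] exceeds the linear loss [2 eta (a - b) r] plus the squared
   distance from [x0] to [x]. *)
pose M := 2 * rho + 2 * eta * (a - b) + enorm (x0 - x) ^+ 2 + 1.
have eab : 0 <= 2 * eta * (a - b) by rewrite !mulr_ge0 // ?subr_ge0 // ltW.
have rho0 : 0 <= rho by exact: normr_ge0.
have E0 := sqr_ge0 (enorm (x0 - x)).
have [|v Kv minv] := compact_minimizer cf cq (@compact_ball x0 M) _ fx0 fNy.
  by rewrite /= subrr normr0 /M; lra.
exists v => z; have [zM|Mz] := leP `|z - x0| M; first exact: minv.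
apply: (@le_trans _ _ (f x0 + (q x0)%:E)).
  by apply: minv; rewrite /= subrr normr0 /M; lra.
case fz : (f z) => [c| |]; last 2 first.
- by rewrite leey.
- by have := fNy z; rewrite fz.
have rz1 : 1 <= r z by rewrite /r; apply: ltW; apply: le_lt_trans Mz; rewrite /M; lra.
have {}low := low _ _ fz rz1.
rewrite fa -!EFinD lee_fin /q.
have h1 : r z - rho <= enorm (z - x).
  apply: le_trans (mx_norm_le_enorm _).
  by rewrite lerBlDr; apply: le_trans (ler_normD _ _); rewrite subrKA.
have h2 : r z * (2 * eta * (a - b)) + enorm (x0 - x) ^+ 2 <= enorm (z - x) ^+ 2.
  apply: (@le_trans _ _ ((r z - rho) ^+ 2)).
    rewrite /M -/(r z) in Mz; nra.
  rewrite ler_pXn2r ?nnegrE ?enorm_ge0 // subr_ge0; rewrite /M -/(r z) in Mz; lra.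
have e2 : 0 < (2 * eta)^-1 by rewrite invr_gt0; lra.
have : (2 * eta)^-1 * (r z * (2 * eta * (a - b)) + enorm (x0 - x) ^+ 2) <=
   (2 * eta)^-1 * enorm (z - x) ^+ 2 by rewrite ler_pM2l.
have -> : (2 * eta)^-1 * (r z * (2 * eta * (a - b)) + enorm (x0 - x) ^+ 2) =
   r z * (a - b) + (2 * eta)^-1 * enorm (x0 - x) ^+ 2.
  by field; rewrite gt_eqF.
lra.
Qed.

(** The objective of the proximal map is strongly convex with modulus [mu + eta^-1]; quadratic
    growth at its minimizer is the three-point inequality. *)
Lemma prox_growth (eta mu : R) f x : 0 < eta -> Defs.proper f -> closed_fun f ->
  convex_fun f -> sconvex mu f ->
  exists2 a, f (prox eta f x) = a%:E & forall y b, f y = b%:E ->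
    a + (2 * eta)^-1 * enorm (prox eta f x - x) ^+ 2
      + (mu + eta^-1) / 2 * enorm (y - prox eta f x) ^+ 2 <=
    b + (2 * eta)^-1 * enorm (y - x) ^+ 2.
Proof.
move=> eta0 pf cf cvf scf; have [v vmin] := prox_exists x eta0 pf cf cvf.
rewrite /prox; case: xgetP => [p _ /= pmin|/(_ v) /=]; last by case.
have [fNy [x0 fx0]] := pf.
have fp : (f p < +oo)%E.
  have := pmin x0; move: fx0 (fNy x0); rewrite /edom /=.
  by case: (f x0) => // r _ _; case: (f p) => [s||] //; rewrite ?ltry ?ltNyy.
have fpE : f p = (fine (f p))%:E by rewrite fineK // fin_numElt fNy.
exists (fine (f p)) => // y b fy.
have eE : (2 * eta)^-1 = eta^-1 / 2 by field; rewrite gt_eqF.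
have scF := sconvexD scf (@sconvex_dist_sqr R m eta^-1 x).
apply: (sconvex_growth scF); rewrite -?eE //; last by rewrite fy.
by rewrite fpE.
Qed.

(** Testing each proximal point in the inequality of the other and adding cancels the values of [f]
    and gives firm nonexpansiveness; Cauchy-Schwarz concludes. *)
Lemma prox_nonexpansive (eta : R) f x y : 0 < eta -> Defs.proper f -> closed_fun f ->
  convex_fun f -> enorm (prox eta f x - prox eta f y) <= enorm (x - y).
Proof.
move=> eta0 pf cf cvf; have scf := convex_sconvex cvf.
have [a fa ha] := prox_growth x eta0 pf cf cvf scf.
have [b fb hb] := prox_growth y eta0 pf cf cvf scf.
have := ha _ _ fb; have {ha}:= hb _ _ fa.
move: (prox eta f x) (prox eta f y) => p q {fa fb}.
have -> : (2 * eta)^-1 = eta^-1 / 2 by field; rewrite gt_eqF.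
move=> h1 h2; have e0 : 0 < eta^-1 by rewrite invr_gt0.
have h : enorm (p - q) ^+ 2 <= dotv (p - q) (x - y).
  rewrite -subr_ge0 -(pmulr_rge0 _ e0).
  have := lerD h1 h2; rewrite -subr_ge0; congr (0 <= _).
  rewrite !enorm_sqr !dotvE (dotvC q p) (dotvC x p) (dotvC y p) (dotvC x q).
  by rewrite (dotvC y q); field; rewrite gt_eqF.
have [->|pq0] := eqVneq (enorm (p - q)) 0; first exact: enorm_ge0.
have pq : 0 < enorm (p - q) by rewrite lt0r pq0 enorm_ge0.
rewrite -(ler_pM2l pq) -expr2; exact: le_trans h (cauchy_schwarz _ _).
Qed.

End Minimizers.

(** * Shuffled passes *)

Section Averages.
Variables (R : realType) (n : nat).
Hypothesis n_gt0 : (0 < n)%N.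

Let nR0 : (0 : R) < n%:R. Proof. by rewrite ltr0n. Qed.

Lemma avg_le (a b : 'I_n -> R) : (forall i, a i <= b i) ->
  n%:R^-1 * \sum_(i < n) a i <= n%:R^-1 * \sum_(i < n) b i.
Proof. by move=> ab; rewrite ler_pM2l ?invr_gt0 //; exact: ler_sum. Qed.

Lemma avg_cst (a : R) : n%:R^-1 * \sum_(i < n) a = a.
Proof. by rewrite sumr_const card_ord -[a *+ n]mulr_natl mulKf // gt_eqF. Qed.

Lemma avgD (a b : 'I_n -> R) : n%:R^-1 * \sum_(i < n) (a i + b i) =
  n%:R^-1 * \sum_(i < n) a i + n%:R^-1 * \sum_(i < n) b i.
Proof. by rewrite big_split mulrDr. Qed.

Lemma avgZ (c : R) (a : 'I_n -> R) : n%:R^-1 * \sum_(i < n) (c * a i) =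
  c * (n%:R^-1 * \sum_(i < n) a i).
Proof. by rewrite -big_distrr /= mulrCA. Qed.

Lemma avgN (a : 'I_n -> R) : n%:R^-1 * \sum_(i < n) (- a i) =
  - (n%:R^-1 * \sum_(i < n) a i).
Proof. by rewrite sumrN mulrN. Qed.

Lemma avg_dotv m (g : 'I_n -> 'rV[R]_m) d :
  dotv (n%:R^-1 *: \sum_(i < n) g i) d = n%:R^-1 * \sum_(i < n) dotv (g i) d.
Proof.
rewrite dotvZl; congr (_ * _).
elim/big_ind2: _ => [|x a y b <- <-|//]; last by rewrite dotvDl.
by rewrite -(scale0r 0) dotvZl mul0r.
Qed.

Lemma avg_enorm m (g : 'I_n -> 'rV[R]_m) :
  enorm (n%:R^-1 *: \sum_(i < n) g i) <= n%:R^-1 * \sum_(i < n) enorm (g i).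
Proof.
rewrite enormZ gtr0_norm ?invr_gt0 //.
by rewrite ler_pM2l ?invr_gt0 //; exact: enorm_sum.
Qed.

Lemma avg_sqr (a : 'I_n -> R) :
  (n%:R^-1 * \sum_(i < n) a i) ^+ 2 <= n%:R^-1 * \sum_(i < n) a i ^+ 2.
Proof.
set b := _ * _.
have : n%:R^-1 * \sum_(i < n) 0 <= n%:R^-1 * \sum_(i < n) (a i - b) ^+ 2.
  by apply: avg_le => i; exact: sqr_ge0.
rewrite avg_cst.
have E i : (a i - b) ^+ 2 = a i ^+ 2 + (- 2 * b * a i + b ^+ 2) by ring.
under eq_bigr do rewrite E.
rewrite avgD avgD avgZ avg_cst -/b; lra.
Qed.

End Averages.

(** * Deviation of a shuffled pass from a full gradient step *)

Section ShuffledPass.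
Variables (R : realType) (n m : nat).
Hypothesis n_gt0 : (0 < n)%N.
Variables (g : 'I_n -> 'rV[R]_m -> 'rV[R]_m) (s : 'S_n) (x : 'rV[R]_m).

Lemma pass_count (a : R) : (pass a g s x).2 = n.
Proof.
rewrite /pass; suff gen (l : seq 'I_n) y k : (foldl
    (fun y i => (y.1 + a *: g (s i) y.1, y.2.+1)) (y, k) l).2 = (k + size l)%N.
  by rewrite gen size_enum_ord.
by elim: l y k => [|i l IH] y k /=; rewrite ?addn0 // IH addnS.
Qed.

Variables (L alpha : R).
Hypotheses (L_ge0 : 0 <= L) (alphaL : `|alpha| * L <= 1 / 2).
Hypothesis g_lip : forall i y z, enorm (g i y - g i z) <= L * enorm (y - z).

Let B := n%:R^-1 * \sum_(i < n) enorm (g i x).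
Let gbar := n%:R^-1 *: \sum_(i < n) g i x.

(* Along the pass the iterates stay within [2 |alpha| B] of [x], so that each
   component map is evaluated up to an error [2 |alpha| L B]. *)
Lemma pass_error :
  enorm ((pass (alpha / n%:R) g s x).1 - (x + alpha *: gbar)) <=
  2 * alpha ^+ 2 * L * B.
Proof.
have nR0 : 0 < n%:R :> R by rewrite ltr0n.
pose a := alpha / n%:R; pose r := 2 * `|alpha| * B.
have B0 : 0 <= B.
  rewrite mulr_ge0 ?invr_ge0 ?(ltW nR0) // sumr_ge0 // => i _; exact: enorm_ge0.
have r0 : 0 <= r by apply: mulr_ge0 => //; exact: mulr_ge0.
have an : `|a| * n%:R = `|alpha|.
  by rewrite /a normrM normfV (gtr0_norm nR0) divfK // gt_eqF.
have nB : n%:R * B = \sum_(i <- enum 'I_n) enorm (g (s i) x).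
  rewrite /B mulrA mulfV ?gt_eqF // mul1r.
  by rewrite (reindex_inj (@perm_inj _ s)) big_enum.
pose y l := (foldl (fun y i => (y.1 + a *: g (s i) y.1, y.2.+1)) (x, 0%N) l).1.
(* Induction on the processed prefix [l], carrying both bounds: the first keeps [y l] within [r] of
   [x], which controls the next component in both. *)
have inv l l' : enum 'I_n = l ++ l' ->
    enorm (y l - x) <= `|a| * (\sum_(i <- l) enorm (g (s i) x) + (size l)%:R * (L * r))
    /\ enorm (y l - (x + a *: \sum_(i <- l) g (s i) x)) <=
       `|a| * ((size l)%:R * (L * r)).
  elim/last_ind: l l' => [|l i IH] l' E.
    by rewrite /y /= !big_nil scaler0 addr0 subrr enorm0 !mul0r addr0 mulr0.
  rewrite cat_rcons in E; have [I1 I2] := IH _ E.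
  have yr : enorm (y l - x) <= r.
    apply: le_trans I1 _.
    have h1 : \sum_(i <- l) enorm (g (s i) x) <= n%:R * B.
      by rewrite nB E big_cat /= lerDl sumr_ge0 // => k _; exact: enorm_ge0.
    have h2 : (size l)%:R * (L * r) <= n%:R * (L * r).
      apply: ler_wpM2r; first exact: mulr_ge0.
      by rewrite ler_nat -[leqRHS](size_enum_ord n) E size_cat leq_addr.
    apply: (@le_trans _ _ (`|a| * (n%:R * B + n%:R * (L * r)))).
      by apply: ler_wpM2l => //; exact: lerD.
    (* The bound on [|alpha| * L] makes [|alpha| * L * r] at most [r / 2], which closes the
       bootstrap on [r]. *)
    rewrite -mulrDr mulrA an /r; have AB := mulr_ge0 (normr_ge0 alpha) B0.
    by have := ler_wpM2r AB alphaL; lra.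
  have gi : enorm (g (s i) (y l) - g (s i) x) <= L * r.
    by apply: le_trans (g_lip _ _ _) _; exact: ler_wpM2l.
  have yE : y (rcons l i) = y l + a *: g (s i) (y l).
    by rewrite /y -cats1 foldl_cat.
  rewrite yE size_rcons -(addn1 (size l)) natrD mulrDl mul1r -cats1 !big_cat /= !big_seq1.
  split.
    have -> : y l + a *: g (s i) (y l) - x =
      (y l - x) + a *: (g (s i) x + (g (s i) (y l) - g (s i) x)).
      by rewrite subrKC addrAC.
    apply: le_trans (enormD _ _) _.
    rewrite addrACA mulrDr; apply: lerD => //; rewrite enormZ.
    by apply: ler_wpM2l => //; apply: le_trans (enormD _ _) _; rewrite lerD2l.
  have -> : y l + a *: g (s i) (y l) - (x + a *: (\sum_(i <- l) g (s i) x + g (s i) x)) =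
      (y l - (x + a *: \sum_(i <- l) g (s i) x)) + a *: (g (s i) (y l) - g (s i) x).
    by rewrite scalerDr scalerBr addrA opprD addrACA.
  apply: le_trans (enormD _ _) _; rewrite mulrDr; apply: lerD => //.
  by rewrite enormZ; exact: ler_wpM2l.
have [_] := inv (enum 'I_n) [::] (esym (cats0 _)).
rewrite size_enum_ord /pass -/(y (enum 'I_n)).
have -> : a *: \sum_(i <- enum 'I_n) g (s i) x = alpha *: gbar.
  rewrite /gbar scalerA; congr (_ *: _).
  by rewrite [RHS](reindex_inj (@perm_inj _ s)) big_enum.
move=> /le_trans; apply; rewrite (mulrA `|a|) an /r -[alpha ^+ 2]real_normK ?num_real //.
by rewrite le_eqVlt; apply/orP; left; apply/eqP; ring.
Qed.

(** By Jensen, [B ^+ 2] is at most the mean of the squared component norms, which is split around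
    [gbar] to use the variance bound. *)
Lemma pass_error_sqr (Theta sigma : R) :
  n%:R^-1 * \sum_(i < n) enorm (g i x - gbar) ^+ 2 <=
    Theta * enorm gbar ^+ 2 + sigma ^+ 2 ->
  enorm ((pass (alpha / n%:R) g s x).1 - (x + alpha *: gbar)) ^+ 2 <=
  8 * alpha ^+ 4 * L ^+ 2 * ((Theta + 1) * enorm gbar ^+ 2 + sigma ^+ 2).
Proof.
move=> var; set V := _ + sigma ^+ 2.
have B2 : B ^+ 2 <= 2 * V.
  apply: le_trans (avg_sqr _ _) _ => //.
  apply: (@le_trans _ _ (n%:R^-1 * \sum_(i < n)
      (2 * enorm (g i x - gbar) ^+ 2 + 2 * enorm gbar ^+ 2))).
    by apply: avg_le => // i; rewrite -{1}(subrK gbar (g i x)) enormD_sqr.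
  by rewrite avgD avg_cst // avgZ /V; lra.
apply: (@le_trans _ _ ((2 * alpha ^+ 2 * L * B) ^+ 2)).
  have h := pass_error; have h0 := le_trans (enorm_ge0 _) h.
  by rewrite ler_pXn2r ?nnegrE ?enorm_ge0.
have -> : (2 * alpha ^+ 2 * L * B) ^+ 2 = (4 * alpha ^+ 4 * L ^+ 2) * B ^+ 2 by ring.
have -> : 8 * alpha ^+ 4 * L ^+ 2 * V = (4 * alpha ^+ 4 * L ^+ 2) * (2 * V) by ring.
apply: ler_wpM2l => //.
have -> : 4 * alpha ^+ 4 * L ^+ 2 = (2 * alpha ^+ 2 * L) ^+ 2 by ring.
exact: sqr_ge0.
Qed.

End ShuffledPass.

(** * Balance of the two step inequalities *)

Section StepInequalities.
Variable R : realType.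

(** Squared distances to the maximizer are [u] before the step, [z] after the exact proximal step
    and [b] after the shuffled one; [d] is the squared length of the exact step, [v] the squared
    pass error, [g] the squared gradient norm. The part of [v] proportional to [d] is absorbed by
    the term in [d] that the exact step leaves over. *)
Lemma ascent_arith (e m L Th sg l0 l1 z d u v g b : R) :
  0 < e -> 0 < m -> 0 <= Th -> 0 <= l0 -> 0 <= l1 ->
  e * L <= 1 / 4 -> e * m <= 1 ->
  5 * e * (8 * L ^+ 2 * (Th + 1) * l0) / m <= 1 / 4 -> 0 <= d -> 0 <= z ->
  (1 + e * m) * z + (1 - 2 * (e * L)) * d <= u ->
  v <= 8 * e ^+ 4 * L ^+ 2 * ((Th + 1) * g + sg ^+ 2) ->
  g <= l0 * (e^-1 ^+ 2 * d) + l1 ->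
  b <= (1 + e * m / 4) * z + (1 + (e * m / 4)^-1) * v ->
  b <= (1 - 3 / 8 * (e * m)) * u +
    5 * (8 * L ^+ 2 * ((Th + 1) * l1 + sg ^+ 2)) / m * e ^+ 3.
Proof.
move=> e0 m0 Th0 l00 l10 eL em noise d0 z0 hz hv hg hb.
have L2 := sqr_ge0 L; have sg2 := sqr_ge0 sg.
have Th1 : 0 <= Th + 1 by exact: addr_ge0.
set M0 := 8 * L ^+ 2 * (Th + 1) * l0 in noise.
set M1 := 8 * L ^+ 2 * ((Th + 1) * l1 + sg ^+ 2).
have M00 : 0 <= M0 by apply: mulr_ge0 => //; do 2!apply: mulr_ge0 => //.
have M10 : 0 <= M1.
  by apply: mulr_ge0; [exact: mulr_ge0|apply: addr_ge0 => //; exact: mulr_ge0].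
have hv' : v <= e ^+ 2 * (M0 * d + M1 * e ^+ 2).
  apply: le_trans hv _.
  have -> : e ^+ 2 * (M0 * d + M1 * e ^+ 2) = 8 * e ^+ 4 * L ^+ 2 *
      ((Th + 1) * (l0 * (e^-1 ^+ 2 * d) + l1) + sg ^+ 2).
    by rewrite /M0 /M1; field; rewrite gt_eqF.
  apply: ler_wpM2l; last by rewrite lerD2r ler_wpM2l.
  have -> : 8 * e ^+ 4 * L ^+ 2 = 8 * (e ^+ 2 * L) ^+ 2 by ring.
  by apply: mulr_ge0 => //; exact: sqr_ge0.
have y0 : 0 < e * m by exact: mulr_gt0.
have h1 : (1 + (e * m / 4)^-1) * v <= 1 / 4 * d + 5 * M1 / m * e ^+ 3.
  have h2 : (1 + (e * m / 4)^-1) <= 5 / (e * m).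
    rewrite invf_div -[X in X + _](@mulfV _ (e * m)) ?gt_eqF // -mulrDl.
    by rewrite ler_pM2r ?invr_gt0 // -lerBrDr; apply: le_trans em _; lra.
  have V0 : 0 <= e ^+ 2 * (M0 * d + M1 * e ^+ 2).
    by apply: mulr_ge0 (sqr_ge0 _) _; apply: addr_ge0; apply: mulr_ge0 => //;
      exact: sqr_ge0.
  apply: (@le_trans _ _ ((1 + (e * m / 4)^-1) * (e ^+ 2 * (M0 * d + M1 * e ^+ 2)))).
    by apply: ler_wpM2l => //; rewrite addr_ge0 // invr_ge0 divr_ge0 // ltW.
  apply: (@le_trans _ _ (5 / (e * m) * (e ^+ 2 * (M0 * d + M1 * e ^+ 2)))).
    exact: ler_wpM2r.
  have -> : 5 / (e * m) * (e ^+ 2 * (M0 * d + M1 * e ^+ 2)) =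
     5 * e * M0 / m * d + 5 * M1 / m * e ^+ 3 by field; rewrite !gt_eqF.
  by rewrite lerD2r; exact: ler_wpM2r.
apply: le_trans hb _; apply: (@le_trans _ _
  ((1 + e * m / 4) * z + (1 / 4 * d + 5 * M1 / m * e ^+ 3))); first by rewrite lerD2l.
rewrite addrA lerD2r; move: (e * m) y0 em hz => y y0 y1 hz.
have hz' : (1 + y) * z + 1 / 2 * d <= u.
  have c : 1 / 2 <= 1 - 2 * (e * L) by move: eL; clear; lra.
  by apply: le_trans hz; rewrite lerD2l; exact: ler_wpM2r.
have c0 : 0 <= 1 - 3 / 8 * y by lra.
have y1' : 0 <= 1 - y by lra.
have := ler_wpM2l c0 hz'; have := mulr_ge0 d0 y1'.
have := mulr_ge0 z0 (mulr_ge0 (ltW y0) y1'); move: d0; clear; lra.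
Qed.

(** As squared norms, [S] is the displacement, [E2] the distance from the pass endpoint to the exact
    gradient step on [Phi0], [r] the pass error, [b] the distance to the maximizer, [G] the gradient
    mapping, [g] and [D] the gradients at [u] and at the maximizer. Noise proportional to [G] is
    absorbed because [eta ^+ 2 * K] is at most 1/80. *)
Lemma descent_arith (eta Lw Lu Th sg l0 l1 psi psi' S E2 r b G g D : R) :
  let K := 16 * Lw ^+ 2 * ((Th + 1) * (l0 + l1 + 1) + sg ^+ 2) in
  0 < eta -> 0 <= Th -> 0 <= l0 -> 0 <= l1 -> 80 * (eta ^+ 2 * K) <= 1 ->
  0 <= S -> 0 <= b -> 0 <= G ->
  psi' + eta^-1 * S / 2 <= psi + eta^-1 * E2 ->
  eta ^+ 2 * G <= 2 * S + 2 * E2 ->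
  E2 <= 2 * r + 2 * (eta ^+ 2 * (Lu ^+ 2 * b)) ->
  r <= 8 * eta ^+ 4 * Lw ^+ 2 * ((Th + 1) * g + sg ^+ 2) ->
  g <= 2 * D + 2 * (Lu ^+ 2 * b) -> D <= l0 * G + l1 ->
  psi' + eta / 16 * G + 3 / 10 * (eta^-1 * S) <=
  psi + eta * (4 * eta ^+ 2 * K + 3 * (Lu ^+ 2 * b)).
Proof.
move=> K e0 Th0 l00 l10 eK S0 b0 G0 h1 h2 h3 h4 h5 h6.
have B0 : 0 <= Lu ^+ 2 * b by apply: mulr_ge0 => //; exact: sqr_ge0.
move: (Lu ^+ 2 * b) B0 h3 h5 => B B0 h3 h5.
have L2 := sqr_ge0 Lw; have sg2 := sqr_ge0 sg.
have Th1 : 0 <= Th + 1 by exact: addr_ge0.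
have hr : r <= eta ^+ 2 * (eta ^+ 2 * K * (G + 1 + B)).
  apply: le_trans h4 _.
  have -> : eta ^+ 2 * (eta ^+ 2 * K * (G + 1 + B)) = 8 * eta ^+ 4 * Lw ^+ 2 *
     (2 * ((Th + 1) * (l0 + l1 + 1) + sg ^+ 2) * (G + 1 + B)) by rewrite /K; ring.
  apply: ler_wpM2l.
    have -> : 8 * eta ^+ 4 * Lw ^+ 2 = 8 * (eta ^+ 2 * Lw) ^+ 2 by ring.
    by apply: mulr_ge0 => //; exact: sqr_ge0.
  apply: (@le_trans _ _ ((Th + 1) * (2 * (l0 * G + l1) + 2 * B) + sg ^+ 2)).
    rewrite lerD2r; apply: ler_wpM2l => //; lra.
  have a1 := mulr_ge0 l00 B0; have a2 := mulr_ge0 l10 B0.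
  have a3 := mulr_ge0 l10 G0.
  have : 0 <= (Th + 1) * (2 * (l0 + l1 + 1) * (G + 1 + B) - (2 * (l0 * G + l1) + 2 * B)).
    apply: mulr_ge0 => //; move: a1 a2 a3 G0 l00 l10; clear; lra.
  have := mulr_ge0 sg2 G0; have := mulr_ge0 sg2 B0; move: sg2; clear; lra.
have [e2 ei] : 0 < eta ^+ 2 /\ 0 < eta^-1 by rewrite invr_gt0 exprn_gt0.
(* Dividing squared displacements by [eta ^+ 2] brings all quantities to the scale of [G]. *)
pose s := eta^-1 ^+ 2 * S; pose t := eta^-1 ^+ 2 * E2.
have SE : S = eta ^+ 2 * s by rewrite /s; field; rewrite gt_eqF.
have EE : E2 = eta ^+ 2 * t by rewrite /t; field; rewrite gt_eqF.
have s0 : 0 <= s by apply: mulr_ge0 => //; exact: sqr_ge0.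
have ht : t <= 2 * (eta ^+ 2 * K * (G + 1 + B)) + 2 * B.
  rewrite -(ler_pM2l e2) -EE; apply: le_trans h3 _.
  by move: hr; clear; lra.
have hG : G <= 2 * s + 2 * t.
  by rewrite -(ler_pM2l e2); apply: le_trans h2 _; rewrite SE EE; clear; lra.
have iS (X : R) : eta^-1 * (eta ^+ 2 * X) = eta * X by field; rewrite gt_eqF.
rewrite SE EE !iS in h1 *.
suff : G / 16 + 3 / 10 * s - s / 2 + t <= 4 * eta ^+ 2 * K + 3 * B.
  move=> /(ler_wpM2l (ltW e0)); move: h1; clear; lra.
have K0 : 0 <= K.
  by rewrite /K; apply: mulr_ge0;
    [exact: mulr_ge0|apply: addr_ge0 => //; apply: mulr_ge0 => //; lra].
have X0 : 0 <= eta ^+ 2 * K by apply: mulr_ge0 => //; exact: ltW.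
rewrite -(mulrA 4); move: (eta ^+ 2 * K) X0 eK ht => X X0 eK ht.
have x1 : 0 <= 1 - 80 * X by lra.
have := mulr_ge0 G0 x1; have := mulr_ge0 B0 x1.
move: ht hG B0 G0 s0 x1 X0; clear; lra.
Qed.

(** Since [e = 30 k^2 eta], the bias [3 eta (k m)^2 b] equals [m / 10 * (e * m) * b]. With the Young
    loss it costs a relative [(1/8 + 1/5) e m], less than the ascent gain [3/8 e m]. The drift of
    the maximizer costs [3/20] of [eta^-1 * S], half of what descent provides. *)
Lemma potential_arith (eta m k K N psi psi' S G d b d' : R) :
  let e := 30 * k ^+ 2 * eta in
  0 < eta -> eta <= 1 -> 0 < m -> 0 < k -> e * m <= 1 ->
  0 <= S -> 0 <= d -> 0 <= N ->
  b <= (1 - 3 / 8 * (e * m)) * d + N ->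
  d' <= (1 + e * m / 8) * b + (1 + (e * m / 8)^-1) * (k ^+ 2 * S) ->
  psi' + eta / 16 * G + 3 / 10 * (eta^-1 * S) <=
    psi + eta * (4 * eta ^+ 2 * K + 3 * ((k * m) ^+ 2 * b)) ->
  psi' + m / 2 * d' + eta / 16 * G <=
    psi + m / 2 * d + (4 * K * eta ^+ 3 + (m + 3 * (k * m) ^+ 2) * N).
Proof.
move=> e e0 e1 m0 k0 em S0 d0 N0 hb hd h.
have k2 : 0 < k ^+ 2 by exact: exprn_gt0.
have y0 : 0 < e * m by rewrite /e !mulr_gt0.
have hS : m / 2 * ((1 + (e * m / 8)^-1) * (k ^+ 2 * S)) <= 3 / 20 * (eta^-1 * S).
  have h2 : (1 + (e * m / 8)^-1) <= 9 / (e * m).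
    rewrite invf_div -[X in X + _](@mulfV _ (e * m)) ?gt_eqF // -mulrDl.
    by rewrite ler_pM2r ?invr_gt0 // -lerBrDr; apply: le_trans em _; lra.
  have -> : 3 / 20 * (eta^-1 * S) = m / 2 * (9 / (e * m) * (k ^+ 2 * S)).
    by rewrite /e; field; rewrite !gt_eqF.
  apply: ler_wpM2l; first by rewrite divr_ge0 // ltW.
  by apply: ler_wpM2r => //; apply: mulr_ge0 => //; exact: ltW.
have kmE : eta * (k * m) ^+ 2 = m / 30 * (e * m) by rewrite /e; field.
have k3 : 0 <= (k * m) ^+ 2 * (1 - eta) by apply: mulr_ge0; [exact: sqr_ge0|lra].
have iS : 0 <= eta^-1 * S by apply: mulr_ge0 => //; rewrite invr_ge0 ltW.
move: (e * m) (eta^-1 * S) (k ^+ 2 * S) y0 em hb hd h hS kmE iS.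
move=> y T Z y0 y1 hb hd h hS kmE iS.
have c0 : 0 <= m / 2 * (1 + y / 8) + m / 10 * y.
  by rewrite addr_ge0 // mulr_ge0 ?divr_ge0 ?addr_ge0 ?divr_ge0 // ltW.
have hb' := ler_wpM2l c0 hb.
have m2 : 0 <= m / 2 by rewrite divr_ge0 // ltW.
have hd' := ler_wpM2l m2 hd.
have h' : eta * (3 * ((k * m) ^+ 2 * b)) = m / 10 * y * b.
  have -> : eta * (3 * ((k * m) ^+ 2 * b)) = 3 * b * (eta * (k * m) ^+ 2) by ring.
  by rewrite kmE; field.
have p1 : 0 <= m * y * d by apply: mulr_ge0 => //; apply: mulr_ge0; exact: ltW.
have p2 : 0 <= m * y * d * y by apply: mulr_ge0 => //; exact: ltW.
have p3 : 0 <= m * N * (1 - y).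
  by apply: mulr_ge0; [apply: mulr_ge0 => //; exact: ltW|lra].
have p4 : 0 <= m * N by apply: mulr_ge0 => //; exact: ltW.
have p5 : 0 <= (k * m) ^+ 2 * N by apply: mulr_ge0 => //; exact: sqr_ge0.
move: h hb' hd' h' p1 p2 p3 p4 p5 hS iS; clear; move: ((k * m) ^+ 2) => Q.
lra.
Qed.

(** Adds the three-point inequality, tested at the current point, to the quadratic upper bound on
    [Phi0]: the gradient products [dN] cancel and only the error product [dE] remains. *)
Lemma prox_descent_arith (eta K a c phi phi' S E2 X dE dN : R) :
  0 < eta -> eta * K <= 1 / 4 -> 0 <= S ->
  a + (2 * eta)^-1 * (S - 2 * (dE - eta * dN) + X) + (0 + eta^-1) / 2 * S <=
    c + (2 * eta)^-1 * X ->
  phi' <= phi + dN + K * S -> dE <= S / 4 + E2 ->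
  a + phi' + eta^-1 * S / 2 <= c + phi + eta^-1 * E2.
Proof.
move=> e0 eK S0 h1 h2 h3.
have ei : 0 < eta^-1 by rewrite invr_gt0.
have EL : a + (2 * eta)^-1 * (S - 2 * (dE - eta * dN) + X) + (0 + eta^-1) / 2 * S =
  a + eta^-1 * S - eta^-1 * dE + dN + (2 * eta)^-1 * X by field; rewrite gt_eqF.
rewrite EL lerD2r in h1.
have hK : K * S <= eta^-1 * (S / 4).
  have -> : K * S = eta^-1 * ((eta * K) * S) by field; rewrite gt_eqF.
  by rewrite ler_pM2l // [S / 4]mulrC; apply: ler_wpM2r => //; rewrite -div1r.
have := ler_wpM2l (ltW ei) h3; move: h1 h2 hK; clear; lra.
Qed.

End StepInequalities.

(** * The minimax problem *)

Section MinimaxProblem.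
Variables (R : realType) (n p q : nat) (P : minimax R n p q).
Variables (Lw Lu muH muh Thetaw sigmaw Thetau sigmau : R).
Hypotheses (n_gt0 : (0 < n)%N) (Lw_ge0 : 0 <= Lw) (Lu_ge0 : 0 <= Lu).
Hypotheses (muH_ge0 : 0 <= muH) (muh_ge0 : 0 <= muh) (mu_gt0 : 0 < muH + muh).
Hypothesis hP : standing P Lw Lu muH muh Thetaw sigmaw Thetau sigmau.

Implicit Types (w d : 'rV[R]_p) (u v : 'rV[R]_q) (i : 'I_n).

Local Notation H := (avgH P).
Local Notation gw := (gradw (avgH P)).
Local Notation gu := (gradu (avgH P)).
Local Notation mu := (muH + muh).
Local Notation kappa := (Lu / (muH + muh)).

(** * Smoothness and concavity of the averaged coupling *)

Lemma enorm_sqr_row_mx (a : 'rV[R]_p) (b : 'rV[R]_q) :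
  enorm (row_mx a b) ^+ 2 = enorm a ^+ 2 + enorm b ^+ 2.
Proof.
rewrite !enorm_sqr /dotv big_split_ord /=; congr (_ + _); apply: eq_bigr => j _.
  by rewrite row_mxEl.
by rewrite row_mxEr.
Qed.

Lemma smooth_components i w w' u u' :
  enorm (gradw (pH P i) w u - gradw (pH P i) w' u') ^+ 2 +
  enorm (gradu (pH P i) w u - gradu (pH P i) w' u') ^+ 2 <=
  Lw ^+ 2 * enorm (w - w') ^+ 2 + Lu ^+ 2 * enorm (u - u') ^+ 2.
Proof.
have := std_H_smooth hP i w w' u u'.
by rewrite /gradwu opp_row_mx add_row_mx enorm_sqr_row_mx.
Qed.

Lemma gradw_lip_w i u w w' :
  enorm (gradw (pH P i) w u - gradw (pH P i) w' u) <= Lw * enorm (w - w').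
Proof.
have := smooth_components i w w' u u; rewrite subrr enorm0 expr0n mulr0 addr0.
move=> h; rewrite -(@ler_pXn2r _ 2) ?nnegrE ?mulr_ge0 ?enorm_ge0 // exprMn.
by apply: le_trans h; rewrite lerDl sqr_ge0.
Qed.

Lemma gradw_lip_u i w u u' :
  enorm (gradw (pH P i) w u - gradw (pH P i) w u') <= Lu * enorm (u - u').
Proof.
have := smooth_components i w w u u'; rewrite subrr enorm0 expr0n mulr0 add0r.
move=> h; rewrite -(@ler_pXn2r _ 2) ?nnegrE ?mulr_ge0 ?enorm_ge0 // exprMn.
by apply: le_trans h; rewrite lerDl sqr_ge0.
Qed.

Lemma gradu_lip_u i w u u' :
  enorm (gradu (pH P i) w u - gradu (pH P i) w u') <= Lu * enorm (u - u').
Proof.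
have := smooth_components i w w u u'; rewrite subrr enorm0 expr0n mulr0 add0r.
move=> h; rewrite -(@ler_pXn2r _ 2) ?nnegrE ?mulr_ge0 ?enorm_ge0 // exprMn.
by apply: le_trans h; rewrite lerDr sqr_ge0.
Qed.

Lemma diff_w i u w : differentiable (fun w' => pH P i w' u) w.
Proof.
apply: (@differentiable_comp _ _ _ _ (fun w' => (w', u))
  (fun z : 'rV[R]_p * 'rV[R]_q => pH P i z.1 z.2)); last exact: std_H_diff hP _ _.
exact: differentiable_pair.
Qed.

Lemma diff_u i w u : differentiable (pH P i w) u.
Proof.
apply: (@differentiable_comp _ _ _ _ (fun u' => (w, u'))
  (fun z : 'rV[R]_p * 'rV[R]_q => pH P i z.1 z.2)); last exact: std_H_diff hP _ _.
exact: differentiable_pair.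
Qed.

(** Stated with the mean of the component gradients, because [gradw_avg] deduces from it that this
    mean is the gradient of the average. *)
Lemma taylor_avg_w w u d :
  `|H (w + d) u - H w u - dotv (n%:R^-1 *: \sum_(i < n) gradw (pH P i) w u) d| <=
  Lw * enorm d ^+ 2.
Proof.
rewrite /avgH avg_dotv -mulrBr -sumrB -mulrBr -sumrB.
rewrite normrM ger0_norm ?invr_ge0 ?ler0n //.
rewrite -[leRHS](avg_cst n_gt0); apply: (@le_trans _ _ (n%:R^-1 *
   \sum_(i < n) `|pH P i (w + d) u - pH P i w u - dotv (gradw (pH P i) w u) d|)).
  by rewrite ler_pM2l ?invr_gt0 ?ltr0n // ler_norm_sum.
apply: avg_le => // i; apply: (@lipschitz_grad_taylor _ _ (fun w' => pH P i w' u)) => //.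
  by move=> y; exact: diff_w.
by move=> x y; exact: gradw_lip_w.
Qed.

Lemma gradw_avg w u : gw w u = n%:R^-1 *: \sum_(i < n) gradw (pH P i) w u.
Proof. by apply: (@grad_unique _ _ _ _ _ Lw) => d; exact: taylor_avg_w. Qed.

Lemma taylor_w w u d :
  `|H (w + d) u - H w u - dotv (gw w u) d| <= Lw * enorm d ^+ 2.
Proof. by rewrite gradw_avg; exact: taylor_avg_w. Qed.

Lemma taylor_avg_u w u (d : 'rV[R]_q) :
  `|H w (u + d) - H w u - dotv (n%:R^-1 *: \sum_(i < n) gradu (pH P i) w u) d| <=
  Lu * enorm d ^+ 2.
Proof.
rewrite /avgH avg_dotv -mulrBr -sumrB -mulrBr -sumrB.
rewrite normrM ger0_norm ?invr_ge0 ?ler0n //.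
rewrite -[leRHS](avg_cst n_gt0); apply: (@le_trans _ _ (n%:R^-1 *
   \sum_(i < n) `|pH P i w (u + d) - pH P i w u - dotv (gradu (pH P i) w u) d|)).
  by rewrite ler_pM2l ?invr_gt0 ?ltr0n // ler_norm_sum.
apply: avg_le => // i; apply: (@lipschitz_grad_taylor _ _ (pH P i w)) => //.
  by move=> y; exact: diff_u.
by move=> x y; exact: gradu_lip_u.
Qed.

Lemma gradu_avg w u : gu w u = n%:R^-1 *: \sum_(i < n) gradu (pH P i) w u.
Proof. by apply: (@grad_unique _ _ _ _ _ Lu) => d; exact: taylor_avg_u. Qed.

Lemma taylor_u w u (d : 'rV[R]_q) :
  `|H w (u + d) - H w u - dotv (gu w u) d| <= Lu * enorm d ^+ 2.
Proof. by rewrite gradu_avg; exact: taylor_avg_u. Qed.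

Lemma avg_gradw_lip_u w u u' : enorm (gw w u - gw w u') <= Lu * enorm (u - u').
Proof.
rewrite !gradw_avg -scalerBr -sumrB; apply: le_trans (avg_enorm n_gt0 _) _.
rewrite -[leRHS](avg_cst n_gt0); apply: avg_le => // i; exact: gradw_lip_u.
Qed.

Lemma avg_sconcave w : sconvex muH (fun u => (- H w u)%:E).
Proof.
move=> u v a b t t01 [<-] [<-]; rewrite lee_fin /avgH -avgN.
have -> : t * - (n%:R^-1 * (\sum_(i < n) pH P i w u)) +
    (1 - t) * - (n%:R^-1 * \sum_(i < n) pH P i w v) -
    muH / 2 * (t * (1 - t)) * enorm (u - v) ^+ 2 =
  n%:R^-1 * \sum_(i < n) ((t * - pH P i w u + (1 - t) * - pH P i w v) -
    muH / 2 * (t * (1 - t)) * enorm (u - v) ^+ 2).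
  by rewrite !avgD avg_cst // !avgZ !avgN.
apply: avg_le => // i.
have := strongly_convex_sconvex (std_H_concave hP i w).
by move=> /(_ u v _ _ t t01 erefl erefl); rewrite lee_fin.
Qed.

Lemma concave_u w u (d : 'rV[R]_q) :
  H w (u + d) <= H w u + dotv (gu w u) d - muH / 2 * enorm d ^+ 2.
Proof. exact: (sconcave_grad (@avg_sconcave w) (@taylor_u w)). Qed.

(** The mean value theorem in [w], applied to the difference of the component functions at [u] and
    [u'], whose gradient is small because [gradw] is Lipschitz in [u]. *)
Lemma cross_difference w w' u u' :
  `|(H w u - H w' u) - (H w u' - H w' u')| <=
  Lu * enorm (u - u') * enorm (w - w').
Proof.
rewrite /avgH -!mulrBr -!sumrB.
rewrite normrM ger0_norm ?invr_ge0 ?ler0n //.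
rewrite -[leRHS](avg_cst n_gt0); apply: (@le_trans _ _ (n%:R^-1 *
   \sum_(i < n) `|pH P i w u - pH P i w' u - (pH P i w u' - pH P i w' u')|)).
  by rewrite ler_pM2l ?invr_gt0 ?ltr0n // ler_norm_sum.
apply: avg_le => // i.
pose F := (fun y => pH P i y u) - (fun y => pH P i y u').
have dF y : differentiable F y by apply: differentiableB; exact: diff_w.
have [t _] := @mean_value _ _ F w' (w - w') dF; rewrite subrKC.
have -> : F w - F w' = pH P i w u - pH P i w' u - (pH P i w u' - pH P i w' u').
  by rewrite /F /= !fctE /=; ring.
move=> ->; apply: le_trans (cauchy_schwarz_norm _ _) _.
apply: ler_wpM2r; first exact: enorm_ge0.
apply: le_trans (gradw_lip_u i _ _ _); rewrite le_eqVlt; apply/orP; left.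
apply/eqP; congr enorm; apply/rowP => j; rewrite !mxE.
by apply: deriveB; apply: diff_derivable; exact: diff_w.
Qed.

(** * The inner maximizer and the regularity of the primal function *)

(** The maximizer of [H w - h], written as a minimizer so that quadratic growth applies; [umax_min]
    shows that it exists. *)
Definition umax w : 'rV[R]_q :=
  xget 0 [set u | forall v, (ph P u + (- H w u)%:E <= ph P v + (- H w v)%:E)%E].

Definition hmax w : R := fine (ph P (umax w)).

Lemma h_gtNy u : (-oo < ph P u)%E.
Proof. by have [[+ _] _ _] := std_h hP. Qed.

Lemma continuous_avgH w : continuous (fun u => - H w u).
Proof.
move=> u.
have c1 : {for u, continuous (fun=> - n%:R^-1 : R)} by exact: cst_continuous.
have c2 : {for u, continuous (\sum_(i < n) pH P i w)}.
  elim/big_ind: _ => [|F G cF cG|i _]; first exact: (@cst_continuous _ _ (0 : R)).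
    exact: (@continuousD R R^o).
  exact: differentiable_continuous (diff_u i w u).
have := continuousM c1 c2; congr continuous_at.
by apply/funext => v; rewrite /avgH /= /GRing.mul /= fct_sumE -mulNr.
Qed.

Lemma umax_min w v :
  (ph P (umax w) + (- H w (umax w))%:E <= ph P v + (- H w v)%:E)%E.
Proof.
have [[_ [u0 hu0]] hcl _] := std_h hP; have [M [Mr hM]] := std_h_bounded hP.
(* The ball contains the bounded domain of [h], and [h] is infinite outside it, so a minimizer over
   the ball is global. *)
have [|u _ umin] := compact_minimizer hcl (@continuous_avgH w)
  (@compact_ball R q 0 (M + 1)) _ hu0 h_gtNy.
  by rewrite /= subr0; apply: hM => //; rewrite ltrDl.
rewrite /umax; case: xgetP => [x _ /=|/(_ u)]; first exact.
case=> z; have [hz|] := boolP (ph P z < +oo)%E.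
  by apply: umin; rewrite /= subr0; apply: hM => //; rewrite ltrDl.
by rewrite -leNgt leye_eq => /eqP ->; rewrite addye // leey.
Qed.

Lemma hmaxE w : ph P (umax w) = (hmax w)%:E.
Proof.
have [[_ [u0 hu0]] _ _] := std_h hP.
rewrite /hmax fineK // fin_numElt h_gtNy /=.
have := umax_min w u0; move: (h_gtNy u0) hu0; rewrite /edom /=.
by case: (ph P u0) => // r _ _; case: (ph P (umax w)) => [s||] //; rewrite ?ltry ?ltNyy.
Qed.

Lemma umax_growth w u c : ph P u = c%:E ->
  (hmax w - H w (umax w)) + mu / 2 * enorm (u - umax w) ^+ 2 <= c - H w u.
Proof.
move=> hu; rewrite (addrC muH).
have sF := sconvexD (strongly_convex_sconvex (std_h_strong hP)) (@avg_sconcave w).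
by apply: (sconvex_growth sF); [exact: umax_min|rewrite hmaxE|rewrite hu].
Qed.

Lemma Phi0E w : Phi0 P w = H w (umax w) - hmax w.
Proof.
rewrite /Phi0; suff -> : ereal_sup (range (fun u => (H w u)%:E - ph P u)%E) =
  (H w (umax w) - hmax w)%:E by [].
apply/le_anti/andP; split.
  apply: ge_ereal_sup => _ [u _ <-]; have := umax_min w u; rewrite hmaxE.
  have := h_gtNy u; case: (ph P u) => [c _|_ _|] //; last exact: leNye.
  by rewrite -!EFinD !lee_fin; lra.
by apply: ereal_sup_ubound; exists (umax w) => //; rewrite hmaxE.
Qed.

Lemma Phi0_ge w u c : ph P u = c%:E -> H w u - c <= Phi0 P w.
Proof.
move=> hu; rewrite Phi0E; have := umax_growth w hu.
have : 0 <= mu / 2 * enorm (u - umax w) ^+ 2.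
  by rewrite mulr_ge0 ?sqr_ge0 // divr_ge0 // ltW.
lra.
Qed.

Opaque umax hmax Phi0 prox grad avgH dotv enorm.

(** Adding the growth inequalities at [w] and [w'] cancels [h] and bounds [mu |du|^2] by the mixed
    difference of [H], at most [Lu |du| |dw|]. *)
Lemma umax_lip w w' : enorm (umax w - umax w') <= kappa * enorm (w - w').
Proof.
have h1 := umax_growth w (hmaxE w'); have h2 := umax_growth w' (hmaxE w).
have := cross_difference w w' (umax w) (umax w').
rewrite ler_norml => /andP[_ h3]; rewrite (enormB (umax w')) in h1.
have [->|e0] := eqVneq (enorm (umax w - umax w')) 0.
  by rewrite mulr_ge0 ?enorm_ge0 // divr_ge0 // ltW.
have ep : 0 < enorm (umax w - umax w') by rewrite lt0r e0 enorm_ge0.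
rewrite mulrAC ler_pdivlMr // -(ler_pM2r ep); lra.
Qed.

(** Danskin's argument: testing [umax w] at [w + d] gives the lower bound, testing [umax (w + d)] at
    [w] the upper one; moving the gradient back to [umax w] costs [Lu * kappa * |d|^2]. *)
Lemma taylor_Phi0 w d :
  `|Phi0 P (w + d) - Phi0 P w - dotv (gw w (umax w)) d| <=
  (Lu * kappa + Lw) * enorm d ^+ 2.
Proof.
have arith (A B x y z v hm hm' G G' k l : R) : 0 <= k -> x - hm <= A ->
    z - hm' <= B -> B = y - hm -> A = v - hm' -> - l <= x - y - G ->
    v - z - G' <= l -> G' - G <= k -> - (k + l) <= A - B - G <= k + l.
  by move=> *; apply/andP; split; lra.
have K0 : 0 <= Lu * kappa * enorm d ^+ 2.
  by rewrite mulr_ge0 ?sqr_ge0 // mulr_ge0 // divr_ge0 // ltW.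
have low := Phi0_ge (w + d) (hmaxE w); have up := Phi0_ge w (hmaxE (w + d)).
have h1 := lerNnormlW (taylor_w w (umax w) d).
have h2 := ler_normlW (taylor_w w (umax (w + d)) d).
have h3 : dotv (gw w (umax (w + d)) - gw w (umax w)) d <= Lu * kappa * enorm d ^+ 2.
  apply: le_trans (cauchy_schwarz _ _) _; rewrite expr2 mulrA.
  apply: ler_wpM2r; first exact: enorm_ge0.
  apply: le_trans (avg_gradw_lip_u _ _ _) _; rewrite -mulrA; apply: ler_wpM2l => //.
  by have := umax_lip (w + d) w; rewrite [w + d - w]addrAC subrr add0r.
rewrite dotvDl dotvNl in h3.
rewrite mulrDl ler_norml.
exact: arith K0 low up (Phi0E _) (Phi0E _) h1 h2 h3.
Qed.

Lemma grad_Phi0 w : grad (Phi0 P) w = gw w (umax w).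
Proof. by apply: grad_unique; exact: taylor_Phi0. Qed.

(** * The ascent epoch *)

(** Chains the three-point inequality at [umax w], concavity from [u] to [umax w], the Taylor bound
    from [u] to [v], and quadratic growth at [v], which supplies the contraction [e * mu]. *)
Lemma prox_ascent_step w u (e : R) : 0 < e ->
  let v := prox e (ph P) (u + e *: gu w u) in
  (1 + e * mu) * enorm (v - umax w) ^+ 2 +
    (1 - 2 * (e * Lu)) * enorm (v - u) ^+ 2 <= enorm (u - umax w) ^+ 2.
Proof.
move=> e0 /=; have [hpr hcl hcv] := std_h hP.
have [a ha /(_ _ _ (hmaxE w))] := prox_growth (u + e *: gu w u) e0 hpr hcl hcv
  (strongly_convex_sconvex (std_h_strong hP)).
have := umax_growth w ha; move: (prox _ _ _) ha => v ha.
have := concave_u w u (umax w - u); have := taylor_u w u (v - u).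
rewrite !subrKC ler_norml => /andP[h2 _] h3 h1.
have E z : enorm (z - (u + e *: gu w u)) ^+ 2 = enorm (z - u) ^+ 2
    - 2 * e * dotv (gu w u) (z - u) + e ^+ 2 * enorm (gu w u) ^+ 2.
  by rewrite opprD addrA enormB_sqr dotvZr enormZ exprMn real_normK ?num_real //
    (dotvC (z - u)) mulrA.
rewrite !{}E (enormB (umax w) v) => h4; rewrite (enormB u (umax w)).
have e2 : 0 <= 2 * e by lra.
have {}h1 := ler_wpM2l e2 h1; have {}h2 := ler_wpM2l e2 h2.
have {}h3 := ler_wpM2l e2 h3; have {}h4 := ler_wpM2l e2 h4.
have S0 : 0 <= e * muH * enorm (umax w - u) ^+ 2.
  by apply: mulr_ge0 (sqr_ge0 _); apply: mulr_ge0 => //; exact: ltW.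
have P0 : 0 <= e * muh * enorm (v - umax w) ^+ 2.
  by apply: mulr_ge0 (sqr_ge0 _); apply: mulr_ge0 => //; exact: ltW.
have EL (A B : R) : 2 * e * (a + (2 * e)^-1 * A + (muh + e^-1) / 2 * B) =
    2 * e * a + A + (e * muh + 1) * B by field; rewrite gt_eqF.
have ER (A : R) : 2 * e * (hmax w + (2 * e)^-1 * A) = 2 * e * hmax w + A.
  by field; rewrite gt_eqF.
rewrite EL ER in h4; lra.
Qed.

Variables (Lam0 Lam1 Lamh0 Lamh1 : R).
Hypotheses (Thetaw_ge0 : 0 <= Thetaw) (Thetau_ge0 : 0 <= Thetau).
Hypotheses (Lam0_ge1 : 1 <= Lam0) (Lam1_ge0 : 0 <= Lam1).
Hypotheses (Lamh0_ge1 : 1 <= Lamh0) (Lamh1_ge0 : 0 <= Lamh1).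

(** Pass error constants once (A) and (B) have replaced gradients by gradient mappings. In the
    ascent error [noise_u0] multiplies the squared exact step and [noise_u1] stays as a constant. *)
Definition noise_w := 16 * Lw ^+ 2 * ((Thetaw + 1) * (Lam0 + Lam1 + 1) + sigmaw ^+ 2).
Definition noise_u0 := 8 * Lu ^+ 2 * (Thetau + 1) * Lamh0.
Definition noise_u1 := 8 * Lu ^+ 2 * ((Thetau + 1) * Lamh1 + sigmau ^+ 2).

Lemma noise_w_ge0 : 0 <= noise_w.
Proof.
have h1 : 0 <= Thetaw + 1 by rewrite addr_ge0.
have h2 : 0 <= Lam0 + Lam1 + 1 by have := Lam0_ge1; have := Lam1_ge0; lra.
by apply: mulr_ge0; [apply: mulr_ge0|apply: addr_ge0; first apply: mulr_ge0];
  rewrite ?sqr_ge0.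
Qed.

Lemma noise_u0_ge0 : 0 <= noise_u0.
Proof.
have h1 : 0 <= Thetau + 1 by rewrite addr_ge0.
have h2 : 0 <= Lamh0 by exact: le_trans ler01 Lamh0_ge1.
by apply: mulr_ge0 => //; apply: mulr_ge0 => //; apply: mulr_ge0; rewrite ?sqr_ge0.
Qed.

Lemma noise_u1_ge0 : 0 <= noise_u1.
Proof.
have h1 : 0 <= Thetau + 1 by rewrite addr_ge0.
by apply: mulr_ge0; [apply: mulr_ge0|apply: addr_ge0; first apply: mulr_ge0];
  rewrite ?sqr_ge0.
Qed.

(** Nonexpansiveness carries the pass error over to the distance from [v] to the exact proximal step
    [z], and (B) bounds the gradient through [z - u]. *)
Lemma ascent_epoch w u (e : R) (s : 'S_n) : 0 < e -> e * Lu <= 1 / 4 ->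
  e * mu <= 1 -> 5 * e * noise_u0 / mu <= 1 / 4 -> domL P w u ->
  condB P e Lamh0 Lamh1 ->
  let v := prox e (ph P)
    (pass (e / n%:R) (fun i u => gradu (pH P i) w u) s u).1 in
  edom (ph P) v /\
  enorm (v - umax w) ^+ 2 <= (1 - 3 / 8 * (e * mu)) * enorm (u - umax w) ^+ 2
    + 5 * noise_u1 / mu * e ^+ 3.
Proof.
move=> e0 eLu emu enoise wu hB /=; have [hpr hcl hcv] := std_h hP.
set x := (pass _ _ _ _).1; set v := prox _ _ _.
have vdom : edom (ph P) v.
  have [a ha _] := prox_growth x e0 hpr hcl hcv (convex_sconvex hcv).
  by rewrite /edom /= ha ltry.
split => //; pose z := prox e (ph P) (u + e *: gu w u).
have hz : (1 + e * mu) * enorm (z - umax w) ^+ 2 +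
    (1 - 2 * (e * Lu)) * enorm (z - u) ^+ 2 <= enorm (u - umax w) ^+ 2.
  exact: prox_ascent_step.
have vz : enorm (v - z) ^+ 2 <= enorm (x - (u + e *: gu w u)) ^+ 2.
  rewrite ler_pXn2r ?nnegrE ?enorm_ge0 //; exact: prox_nonexpansive.
have ue : `|e| * Lu <= 1 / 2 by rewrite gtr0_norm //; lra.
have := pass_error_sqr n_gt0 s Lu_ge0 ue (fun i => gradu_lip_u i w) (x := u)
  (Theta := Thetau) (sigma := sigmau).
rewrite -gradu_avg => /(_ (std_var_u hP w u)); rewrite -/x => /(le_trans vz) {}vz.
have := hB w u wu; rewrite /gradmapu -/z enormZ exprMn real_normK ?num_real //.
rewrite (enormB u z) => hg.
clearbody v z x.
have := enormD_sqr_weighted (z - umax w) (v - z) (a := e * mu / 4).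
have -> : z - umax w + (v - z) = v - umax w by rewrite addrC subrKA.
have y4 : 0 < e * mu / 4 by rewrite divr_gt0 // mulr_gt0.
move=> /(_ y4) {y4}.
move=> hb; have l0 : 0 <= Lamh0 by exact: le_trans ler01 Lamh0_ge1.
by apply: (ascent_arith e0 mu_gt0 Thetau_ge0 l0 Lamh1_ge0 eLu emu enoise
  (sqr_ge0 _) (sqr_ge0 _) hz vz hg hb).
Qed.

(** * The descent epoch *)

(** [Psi0] as a real number; the two agree on the domain of [f], by [Psi0E]. *)
Definition psi w : R := fine (pf P w) + Phi0 P w.

(** The pass endpoint [x] misses the exact gradient step on [Phi0] by [d], the sum of the pass error
    and the bias of using [u] for [umax w]; nonexpansiveness bounds the gradient mapping through
    [v - w] and [d]. *)
Lemma descent_epoch w u (eta : R) (s : 'S_n) : 0 < eta -> eta * Lw <= 1 / 2 ->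
  eta * (Lu * kappa + Lw) <= 1 / 4 -> 80 * (eta ^+ 2 * noise_w) <= 1 ->
  edom (pf P) w -> condA P eta Lam0 Lam1 ->
  let v := prox eta (pf P)
    (pass (- (eta / n%:R)) (fun i w => gradw (pH P i) w u) s w).1 in
  edom (pf P) v /\
  psi v + eta / 16 * enorm (gradmap P eta w) ^+ 2
    + 3 / 10 * (eta^-1 * enorm (v - w) ^+ 2) <=
  psi w + eta * (4 * eta ^+ 2 * noise_w + 3 * (Lu ^+ 2 * enorm (u - umax w) ^+ 2)).
Proof.
move=> e0 eLw eL enoise wf hA /=; have [fpr fcl fcv] := std_f hP.
set x := (pass _ _ _ _).1; set v := prox _ _ _.
have [a ha hv] := prox_growth x e0 fpr fcl fcv (convex_sconvex fcv).
rewrite -/v in ha hv.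
split; first by rewrite /edom /= ha ltry.
pose z := prox eta (pf P) (w - eta *: gw w (umax w)).
pose d := x - (w - eta *: gw w (umax w)).
have vz : enorm (v - z) ^+ 2 <= enorm d ^+ 2.
  by rewrite ler_pXn2r ?nnegrE ?enorm_ge0 //; exact: prox_nonexpansive.
have GE : enorm (gradmap P eta w) ^+ 2 = eta^-1 ^+ 2 * enorm (w - z) ^+ 2.
  by rewrite /gradmap grad_Phi0 -/z enormZ exprMn real_normK ?num_real.
have fw : pf P w = (fine (pf P w))%:E.
  by have [fNy _] := fpr; rewrite fineK // fin_numElt fNy.
have ae : `|- eta| * Lw <= 1 / 2 by rewrite normrN gtr0_norm.
have := pass_error_sqr n_gt0 s Lw_ge0 ae (fun i => gradw_lip_w i u) (x := w)
  (Theta := Thetaw) (sigma := sigmaw).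
rewrite -gradw_avg mulNr -/x => /(_ (std_var_w hP w u)).
have -> : (- eta) ^+ 4 = eta ^+ 4 by ring.
rewrite scaleNr => hr.
have hD := hA w; rewrite grad_Phi0 in hD.
have {}hv := hv _ _ fw.
have hPhi := ler_normlW (taylor_Phi0 w (v - w)); rewrite subrKC in hPhi.
rewrite /psi ha /=; clearbody v z x.
have l0 : 0 <= Lam0 by exact: le_trans ler01 Lam0_ge1.
apply: (descent_arith (E2 := enorm d ^+ 2) e0 Thetaw_ge0 l0 Lam1_ge0 enoise
  (sqr_ge0 _) (sqr_ge0 _) (sqr_ge0 _) _ _ _ hr _ hD).
- apply: (prox_descent_arith (X := enorm (w - x) ^+ 2)
    (dE := dotv (v - w) d) (dN := dotv (v - w) (gw w (umax w))) e0 eL (sqr_ge0 _)).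
  + apply: le_trans hv; rewrite le_eqVlt; apply/orP; left; apply/eqP.
    rewrite [enorm (w - v)]enormB; congr (_ + _ * _ + _).
    have dE : d - eta *: gw w (umax w) = x - w.
      by rewrite /d opprB addrA addrAC addrK.
    rewrite [enorm (w - x)]enormB -dE.
    have -> : v - x = (v - w) - (d - eta *: gw w (umax w)).
      by rewrite dE opprB addrA subrK.
    by rewrite (enormB_sqr (v - w)) dotvDr dotvNr dotvZr.
  + rewrite (dotvC (v - w)); move: hPhi; rewrite !lerBlDr => /le_trans; apply.
    by rewrite [leLHS]addrC [X in _ + X <= _]addrC addrA.
  + apply: le_trans (cauchy_schwarz _ _) _.
    rewrite -subr_ge0; have -> : enorm (v - w) ^+ 2 / 4 + enorm d ^+ 2
        - enorm (v - w) * enorm d = (enorm (v - w) / 2 - enorm d) ^+ 2 by field.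
    exact: sqr_ge0.
- rewrite GE mulrA -exprMn mulfV ?gt_eqF // expr1n mul1r.
  have -> : w - z = (w - v) + (v - z) by rewrite subrKA.
  apply: le_trans (enormD_sqr _ _) _; rewrite [enorm (w - v)]enormB lerD2l.
  by rewrite ler_pM2l.
- have -> : d = (x - (w - eta *: gw w u)) +
      eta *: (gw w (umax w) - gw w u).
    by rewrite /d scalerBr !opprB -[RHS]addrA [X in _ = _ + X]addrC subrKA.
  apply: le_trans (enormD_sqr _ _) _; rewrite lerD2l ler_pM2l // enormZ exprMn.
  rewrite real_normK ?num_real //; apply: ler_wpM2l; first exact: sqr_ge0.
  rewrite -exprMn ler_pXn2r ?nnegrE ?mulr_ge0 ?enorm_ge0 //.
  by rewrite (enormB u); exact: avg_gradw_lip_u.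
- have -> : gw w u = gw w (umax w) + (gw w u - gw w (umax w)) by rewrite subrKC.
  apply: le_trans (enormD_sqr _ _) _; rewrite lerD2l ler_pM2l // -exprMn.
  rewrite ler_pXn2r ?nnegrE ?mulr_ge0 ?enorm_ge0 //.
  exact: avg_gradw_lip_u.
Qed.

(** * The potential and its decrease along a run *)

(** Coefficient of [eta ^+ 3] in the loss of one epoch; the cube of [30 * kappa ^+ 2] converts the
    ascent step into [eta]. *)
Definition epoch_noise : R :=
  4 * noise_w + (mu + 3 * Lu ^+ 2) * (5 * noise_u1 / mu * (30 * kappa ^+ 2) ^+ 3).

(* Inverse of the largest step size allowed by [ascent_epoch] and [descent_epoch]. *)
Definition step_denom : R := 1 + 120 * kappa ^+ 2 * Lu + 30 * kappa ^+ 2 * mu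
  + 600 * kappa ^+ 2 * noise_u0 / mu + 2 * Lw + 4 * (Lu * kappa + Lw) + 80 * noise_w.

(* For [Lu = 0] the prescribed step size of the ascent pass is 0, so that the
   distance to the maximizer cannot decrease; but then [gradw] does not depend
   on [u] either. *)
Definition dist_weight : R := if Lu == 0 then 0 else mu / 2.

Definition potential w u : R := psi w + dist_weight * enorm (u - umax w) ^+ 2.

Lemma kappa_ge0 : 0 <= kappa.
Proof. by rewrite divr_ge0 // ltW. Qed.

Lemma ascent_noise_ge0 :
  0 <= (mu + 3 * Lu ^+ 2) * (5 * noise_u1 / mu * (30 * kappa ^+ 2) ^+ 3).
Proof.
apply: mulr_ge0; first by rewrite addr_ge0 ?(ltW mu_gt0) // mulr_ge0 // sqr_ge0.
apply: mulr_ge0; first by rewrite divr_ge0 ?(ltW mu_gt0) // mulr_ge0 // noise_u1_ge0.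
by apply: exprn_ge0; apply: mulr_ge0 => //; exact: sqr_ge0.
Qed.

Lemma epoch_noise_ge0 : 0 <= epoch_noise.
Proof. by rewrite addr_ge0 ?ascent_noise_ge0 // mulr_ge0 // noise_w_ge0. Qed.

Lemma step_denom_ge1 : 1 <= step_denom.
Proof.
have arith (a1 a2 a3 a4 a5 a6 : R) : 0 <= a1 -> 0 <= a2 -> 0 <= a3 -> 0 <= a4 ->
    0 <= a5 -> 0 <= a6 -> 1 <= 1 + a1 + a2 + a3 + a4 + a5 + a6 by lra.
have k2 := sqr_ge0 kappa; have m0 := ltW mu_gt0; have k0 := kappa_ge0.
have Lk := addr_ge0 (mulr_ge0 Lu_ge0 k0) Lw_ge0.
exact: arith (mulr_ge0 (mulr_ge0 (ler0n R 120) k2) Lu_ge0)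
  (mulr_ge0 (mulr_ge0 (ler0n R 30) k2) m0)
  (divr_ge0 (mulr_ge0 (mulr_ge0 (ler0n R 600) k2) noise_u0_ge0) m0)
  (mulr_ge0 (ler0n R 2) Lw_ge0) (mulr_ge0 (ler0n R 4) Lk)
  (mulr_ge0 (ler0n R 80) noise_w_ge0).
Qed.

Lemma step_denom_bounds (eta : R) : 0 < eta -> eta * step_denom <= 1 ->
  [/\ eta <= 1, 30 * kappa ^+ 2 * eta * Lu <= 1 / 4, 30 * kappa ^+ 2 * eta * mu <= 1,
      5 * (30 * kappa ^+ 2 * eta) * noise_u0 / mu <= 1 / 4 &
   [/\ eta * Lw <= 1 / 2, eta * (Lu * kappa + Lw) <= 1 / 4 &
       80 * (eta ^+ 2 * noise_w) <= 1]].
Proof.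
have arith (e a1 a2 a3 a4 a5 a6 : R) : 0 < e ->
    e * (1 + 120 * a1 + 30 * a2 + 600 * a3 + 2 * a4 + 4 * a5 + 80 * a6) <= 1 ->
    [/\ 0 <= a1, 0 <= a2 & 0 <= a3] -> [/\ 0 <= a4, 0 <= a5 & 0 <= a6] ->
    [/\ e <= 1, 30 * (e * a1) <= 1 / 4, 30 * (e * a2) <= 1, 150 * (e * a3) <= 1 / 4 &
     [/\ e * a4 <= 1 / 2, e * a5 <= 1 / 4 & 80 * (e * (e * a6)) <= 1]].
  move=> e0 h [p1 p2 p3] [p4 p5 p6].
  have {}p1 := mulr_ge0 (ltW e0) p1; have {}p2 := mulr_ge0 (ltW e0) p2.
  have {}p3 := mulr_ge0 (ltW e0) p3; have {}p4 := mulr_ge0 (ltW e0) p4.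
  have {}p5 := mulr_ge0 (ltW e0) p5; have {}p6 := mulr_ge0 (ltW e0) p6.
  have e1 : e <= 1 by lra.
  by split; [| | | |split]; try lra;
    apply: le_trans (ler_wpM2l _ (ler_piMl p6 e1)) _ => //; lra.
have k2 := sqr_ge0 kappa; have mu0 := ltW mu_gt0.
have k0 := kappa_ge0; have n0 := noise_u0_ge0.
have q1 : 0 <= kappa ^+ 2 * Lu by exact: mulr_ge0.
have q2 : 0 <= kappa ^+ 2 * mu by exact: mulr_ge0.
have q3 : 0 <= kappa ^+ 2 * noise_u0 / mu.
  by rewrite divr_ge0 // mulr_ge0.
have q5 : 0 <= Lu * kappa + Lw by rewrite addr_ge0 // mulr_ge0.
have E : step_denom = 1 + 120 * (kappa ^+ 2 * Lu) + 30 * (kappa ^+ 2 * mu)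
    + 600 * (kappa ^+ 2 * noise_u0 / mu) + 2 * Lw + 4 * (Lu * kappa + Lw)
    + 80 * noise_w by rewrite /step_denom; ring.
rewrite {}E => e0 h.
have [] := arith _ _ _ _ _ _ _ e0 h (And3 q1 q2 q3) (And3 Lw_ge0 q5 noise_w_ge0).
move=> h1 h2 h3 h4 [h5 h6 h7]; split => //.
- by have -> : 30 * kappa ^+ 2 * eta * Lu = 30 * (eta * (kappa ^+ 2 * Lu)) by ring.
- by have -> : 30 * kappa ^+ 2 * eta * mu = 30 * (eta * (kappa ^+ 2 * mu)) by ring.
- have -> : 5 * (30 * kappa ^+ 2 * eta) * noise_u0 / mu =
    150 * (eta * (kappa ^+ 2 * noise_u0 / mu)) by ring.
  by [].
- by split => //; rewrite expr2 -(mulrA eta).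
Qed.

(** The domain of [h] is tracked only for nonzero [Lu], since a zero ascent step falls outside the
    proximal lemmas. *)
Lemma epoch_descent (st : alg_state R p q) (eta : R) (pi pih : 'S_n) :
  0 < eta -> eta * step_denom <= 1 ->
  edom (pf P) (st_w st) -> (Lu != 0 -> edom (ph P) (st_u st)) ->
  condA P eta Lam0 Lam1 -> condB P (30 * kappa ^+ 2 * eta) Lamh0 Lamh1 ->
  let st' := epoch P eta (30 * kappa ^+ 2 * eta) pi pih st in
  [/\ edom (pf P) (st_w st'), Lu != 0 -> edom (ph P) (st_u st') &
   potential (st_w st') (st_u st')
     + eta / 16 * enorm (gradmap P eta (st_w st)) ^+ 2 <=
   potential (st_w st) (st_u st) + epoch_noise * eta ^+ 3].
Proof.
have arith0 (e p1 p2 G S N Z : R) : 0 < e -> 0 <= S -> 0 <= Z ->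
    p2 + e / 16 * G + 3 / 10 * (e^-1 * S) <= p1 + e * (4 * e ^+ 2 * N) ->
    p2 + e / 16 * G <= p1 + (4 * N + Z) * e ^+ 3.
  move=> e0 S0 Z0; have := mulr_ge0 Z0 (exprn_ge0 3 (ltW e0)).
  have : 0 <= e^-1 * S by rewrite mulr_ge0 // invr_ge0 ltW.
  lra.
move=> e0 ed wf uh hA hB /=.
have [e1 eLu emu en0 [eLw eL enw]] := step_denom_bounds e0 ed.
set u' := prox _ (ph P) _.
have [wf' hd] := descent_epoch u' pih e0 eLw eL enw wf hA; move: wf' hd.
rewrite -/u'; set w' := prox eta _ _ => wf' hd.
(* If [Lu = 0], the distance term vanishes from the descent bound, which then suffices alone. *)
rewrite /potential /dist_weight; have [Lu0|Lu0] := eqVneq Lu 0.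
  split => //; rewrite !mul0r !addr0.
  apply: arith0 e0 (sqr_ge0 (enorm (w' - st_w st))) ascent_noise_ge0 _.
  by move: hd; rewrite {1}Lu0 expr0n mul0r mulr0 addr0.
have k0 : 0 < kappa by rewrite divr_gt0 // lt0r Lu0.
have ee0 : 0 < 30 * kappa ^+ 2 * eta.
  by apply: mulr_gt0 => //; apply: mulr_gt0 => //; exact: exprn_gt0.
have [uh' ha] := ascent_epoch pi ee0 eLu emu en0 (conj wf (uh Lu0)) hB.
rewrite -/u' in uh' ha.
split => //.
have kmu : kappa * mu = Lu by rewrite divfK // gt_eqF.
have N0 : 0 <= 5 * noise_u1 / mu * (30 * kappa ^+ 2 * eta) ^+ 3.
  apply: mulr_ge0; first by rewrite divr_ge0 ?(ltW mu_gt0) // mulr_ge0 // noise_u1_ge0.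
  exact: exprn_ge0 (ltW ee0).
have hu : enorm (u' - umax w') ^+ 2 <=
    (1 + 30 * kappa ^+ 2 * eta * mu / 8) * enorm (u' - umax (st_w st)) ^+ 2 +
    (1 + (30 * kappa ^+ 2 * eta * mu / 8)^-1) *
      (kappa ^+ 2 * enorm (w' - st_w st) ^+ 2).
  have y0 : 0 < 30 * kappa ^+ 2 * eta * mu / 8 by rewrite divr_gt0 // mulr_gt0.
  have -> : u' - umax w' = (u' - umax (st_w st)) + (umax (st_w st) - umax w').
    by rewrite subrKA.
  apply: le_trans (enormD_sqr_weighted _ _ y0) _; rewrite lerD2l.
  apply: ler_wpM2l; first by rewrite addr_ge0 // invr_ge0 ltW.
  rewrite -exprMn (enormB w'); have hl := umax_lip (st_w st) w'.
  by rewrite ler_pXn2r ?nnegrE ?enorm_ge0 // (le_trans (enorm_ge0 _) hl).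
rewrite -kmu in hd.
have := potential_arith e0 e1 mu_gt0 k0 emu (sqr_ge0 _) (sqr_ge0 _) N0 ha hu hd.
rewrite kmu; congr (_ <= _ + _).
rewrite /epoch_noise [RHS]mulrDl [(_ * eta) ^+ 3]exprMn; congr (_ + _).
by rewrite !mulrA.
Qed.

Section Run.
Variables (eta : R) (pi pih : nat -> 'S_n) (w0 : 'rV[R]_p) (u0 : 'rV[R]_q).
Hypotheses (eta_gt0 : 0 < eta) (eta_small : eta * step_denom <= 1).
Hypotheses (w0_dom : edom (pf P) w0) (u0_dom : edom (ph P) u0).
Hypotheses (hA : condA P eta Lam0 Lam1)
  (hB : condB P (30 * kappa ^+ 2 * eta) Lamh0 Lamh1).

Local Notation run := (alg P (fun=> eta) (fun=> 30 * kappa ^+ 2 * eta) pi pih w0 u0).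

Lemma run_counts t : st_nw (run t) = (t * n)%N /\ st_nu (run t) = (t * n)%N.
Proof. by elim: t => //= t [-> ->]; rewrite !pass_count // mulSn addnC. Qed.

Lemma run_descent T :
  [/\ edom (pf P) (st_w (run T)), Lu != 0 -> edom (ph P) (st_u (run T)) &
   potential (st_w (run T)) (st_u (run T)) +
     eta / 16 * \sum_(0 <= t < T) enorm (gradmap P eta (st_w (run t))) ^+ 2 <=
   potential w0 u0 + T%:R * (epoch_noise * eta ^+ 3)].
Proof.
have arith (V V' V0 S G N M k : R) : V + k * S <= V0 + M * N ->
    V' + k * G <= V + N -> V' + k * (S + G) <= V0 + (M + 1) * N by lra.
elim: T => [|T [wf uh IH]].
  by split => //; rewrite big_geq // mulr0 mul0r !addr0.
have [wf' uh' h] := epoch_descent (pi T.+1) (pih T.+1) eta_gt0 eta_small wf uh hA hB.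
split; [exact: wf'|exact: uh'|].
rewrite big_nat_recr // -(natr1 T); exact: arith IH h.
Qed.

Lemma Psi0E w : edom (pf P) w -> Psi0 P w = (psi w)%:E.
Proof.
move=> wf; have [[fNy _] _ _] := std_f hP.
have fE : pf P w = (fine (pf P w))%:E by rewrite fineK // fin_numElt fNy.
by rewrite /Psi0 fE.
Qed.

(** The potential stays above [psi w0 - D0], and quadratic growth bounds its initial distance term
    by [D1], which is the gap between [Phi0] and [H - h] at the starting point. *)
Lemma gradmap_average (D0 D1 : R) T :
  (Psi0 P w0 - Psi0star P)%E = D0%:E ->
  (Psi0 P w0 - Lagr P w0 u0)%E = D1%:E ->
  0 <= D0 + D1 /\
  eta / 16 * \sum_(0 <= t < T) enorm (gradmap P eta (st_w (run t))) ^+ 2 <=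
  D0 + D1 + T%:R * (epoch_noise * eta ^+ 3).
Proof.
have arith (V S M a D W D' : R) : V + S <= a + W + M -> a - D <= V -> W <= D' ->
    S <= D + D' + M by lra.
rewrite Psi0E // => hD0 hD1.
have star : Psi0star P = (psi w0 - D0)%:E.
  move: hD0; case: (Psi0star P) => [r||] //; rewrite -EFinB => -[<-].
  by rewrite subKr.
have low w : edom (pf P) w -> psi w0 - D0 <= psi w.
  move=> wf; rewrite -lee_fin -star -Psi0E //.
  by apply: ereal_inf_lbound; exists w.
have hu : ph P u0 = (fine (ph P u0))%:E by rewrite fineK // fin_numElt h_gtNy.
have D1E : D1 = (fine (ph P u0) - H w0 u0) - (hmax w0 - H w0 (umax w0)).
  have fw : pf P w0 = (fine (pf P w0))%:E.
    by have [[fNy _] _ _] := std_f hP; rewrite fineK // fin_numElt fNy.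
  move: hD1; rewrite /Lagr hu fw -?EFinD -?EFinB -?EFinD -?EFinB => -[<-].
  by rewrite /psi Phi0E; ring.
have gr := umax_growth w0 hu.
have d0 : 0 <= mu / 2 * enorm (u0 - umax w0) ^+ 2.
  by apply: mulr_ge0; [rewrite divr_ge0 // ltW|exact: sqr_ge0].
have hW : mu / 2 * enorm (u0 - umax w0) ^+ 2 <= D1.
  by rewrite D1E lerBrDl.
have wle : dist_weight * enorm (u0 - umax w0) ^+ 2 <= D1.
  rewrite /dist_weight; case: eqP => // _; rewrite mul0r; exact: le_trans d0 hW.
split.
  apply: addr_ge0; last exact: le_trans d0 hW.
  by have := low _ w0_dom; rewrite lerBlDr lerDl.
have [wf _ h] := run_descent T.
apply: arith h _ wle; apply: le_trans (low _ wf) _.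
rewrite lerDl mulr_ge0 ?sqr_ge0 // /dist_weight; case: eqP => // _.
by rewrite divr_ge0 // ltW.
Qed.

End Run.

End MinimaxProblem.

(** * Random output index *)

Section RandomOutput.
Context (R : realType) (d : measure_display) (Omega : measurableType d).
Variable Pr : probability Omega R.

Lemma expectation_finite (A : finType) (Z : Omega -> A) (f : A -> R) :
  discrete_rv Z -> (forall a, 0 <= f a) ->
  ('E_Pr[fun o => f (Z o)] = \sum_(a : A) (f a)%:E * Pr [set o | Z o = a])%E.
Proof.
move=> mZ f0; rewrite unlock.
under eq_integral => o _.
  have -> : (f (Z o))%:E =
      (\sum_(a : A) (f a)%:E * (\1_[set o | Z o = a] o)%:E)%E.
    rewrite (bigD1 (Z o)) //= big1 ?adde0 => [|a /negP aZ].
      by rewrite indicE mem_set // mule1.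
    by rewrite indicE memNset ?mule0 // => /= Za; apply: aZ; rewrite Za.
  over.
have m1 a : measurable_fun setT (\1_[set o | Z o = a] : Omega -> R).
  exact: measurable_indic.
rewrite ge0_integral_sum //.
- apply: eq_bigr => a _; rewrite ge0_integralZl_EFin //.
  - by rewrite integral_indic // setIT.
  - by apply/measurable_EFinP; exact: m1.
- by move=> a; apply: measurable_funeM; apply/measurable_EFinP; exact: m1.
- by move=> a o _; rewrite mule_ge0 // lee_fin.
Qed.

(** Up to time [T] the permutations have finitely many joint outcomes [a], so the expectation is a
    finite sum over [a] and the index. Given [a] the run is deterministic, and under either output
    rule its contribution is at most its time average times the probability of [a]. *)
Lemma expectation_output (n T : nat) (M : R)
  (X : (nat -> 'S_n) -> (nat -> 'S_n) -> nat -> R)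
  (pi pih : nat -> Omega -> 'S_n) (ts : Omega -> 'I_T.+1) :
  (forall s sh t, 0 <= X s sh t) ->
  (forall s s' sh sh' t, (forall k, (1 <= k <= t)%N -> s k = s' k /\ sh k = sh' k) ->
    X s sh t = X s' sh' t) ->
  (forall s sh, T.+1%:R^-1 * \sum_(0 <= t < T.+1) X s sh t <= M) ->
  (forall k, discrete_rv (pi k)) -> (forall k, discrete_rv (pih k)) ->
  discrete_rv ts ->
  argmin_output (fun o => X (pi^~ o) (pih^~ o)) ts \/ uniform_output Pr pi pih ts ->
  ('E_Pr[fun o => X (pi^~ o) (pih^~ o) (ts o)] <= M%:E)%E.
Proof.
move=> X0 Xloc Xavg mpi mpih mts out.
pose A := {ffun 'I_T -> 'S_n * 'S_n}.
(* Epoch [k] is stored at index [k - 1]; [Xloc] makes the values outside [1, ..., T] harmless. *)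
pose pick (a : A) k := if (insub k.-1 : option 'I_T) is Some i then a i else (1, 1)%g.
pose code o : A := [ffun i : 'I_T => (pi i.+1 o, pih i.+1 o)].
pose Y (a : A) t := X (fun k => (pick a k).1) (fun k => (pick a k).2) t.
pose E (a : A) := [set o | code o = a].
have codeP o k : (1 <= k <= T)%N -> pick (code o) k = (pi k o, pih k o).
  by case: k => // k kT; rewrite /pick /= insubT ffunE.
have EE a : E a = [set o | forall k, (1 <= k <= T)%N ->
    pi k o = (pick a k).1 /\ pih k o = (pick a k).2].
  apply/seteqP; split => o /=.
    by move=> <- k kT; rewrite codeP.
  move=> h; apply/ffunP => i; rewrite ffunE; have := h i.+1 (ltn_ord i).
  by rewrite /pick valK; case: (a i) => a1 a2 /= [-> ->].
have mE a : measurable (E a).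
  have -> : E a = \bigcap_(k in [set k | (1 <= k <= T)%N])
      ([set o | pi k o = (pick a k).1] `&` [set o | pih k o = (pick a k).2]).
    by rewrite EE; apply/seteqP; split => o h k /h.
  apply: bigcap_measurableType => k _; apply: measurableI; [exact: mpi|exact: mpih].
have XY o (t : 'I_T.+1) : X (pi^~ o) (pih^~ o) t = Y (code o) t.
  apply: Xloc => k /andP[k1 kt].
  by rewrite codeP ?k1 //= (leq_trans kt) // -ltnS.
have mZ : discrete_rv (fun o => (code o, ts o)).
  move=> [a t].
  have -> : [set o | (code o, ts o) = (a, t)] = E a `&` [set o | ts o = t].
    by apply/seteqP; split => o /= [ca ct]; [split|rewrite ct; congr (_, _)].
  by apply: measurableI; [exact: mE|exact: mts].
have ind : ('E_Pr[fun o => X (pi^~ o) (pih^~ o) (ts o)] =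
   \sum_(a : A) \sum_(t < T.+1) (Y a t)%:E * Pr (E a `&` [set o | ts o = t]))%E.
  have -> : (fun o => X (pi^~ o) (pih^~ o) (ts o)) = (fun o => Y (code o) (ts o)).
    by apply/funext => o; exact: XY.
  have := @expectation_finite _ (fun o => (code o, ts o)) (fun z => Y z.1 z.2) mZ.
  move=> /= -> => [|z]; last exact: X0.
  rewrite pair_bigA /=; apply: eq_bigr => -[a t] _ /=; congr (_ * Pr _)%E.
  by apply/seteqP; split => o /= [ca ct]; [split|rewrite ct; congr (_, _)].
have sumE : (\sum_(a : A) Pr (E a) = 1)%E.
  have := @expectation_finite _ code (fun=> 1) _ (fun=> ler01).
  rewrite expectation_cst => -> //.
  by apply: eq_bigr => a _; rewrite mul1e.
rewrite {}ind.
suff row a : (\sum_(t < T.+1) (Y a t)%:E * Pr (E a `&` [set o | ts o = t]) <=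
    M%:E * Pr (E a))%E.
  apply: (@le_trans _ _ (\sum_(a : A) M%:E * Pr (E a))%E); first exact: lee_sum.
  by rewrite -ge0_sume_distrr // sumE mule1.
have avgY : \sum_(t < T.+1) Y a t <= T.+1%:R * M.
  have := Xavg (fun k => (pick a k).1) (fun k => (pick a k).2).
  by rewrite mulrC ler_pdivrMr ?ltr0n // mulrC big_mkord.
case: out => [amin|[unif indep]].
  have Esum : (\sum_(t < T.+1) Pr (E a `&` [set o | ts o = t]) = Pr (E a))%E.
    rewrite fsbig_seq ?index_enum_uniq // -measure_fin_bigcup //.
    - congr (Pr _); apply/seteqP; split => x; first by move=> [t _ []].
      by move=> xa; exists (ts x) => //=; rewrite mem_index_enum.
    - by move=> s t _ _ [x [[_ /= <-] [_ /= <-]]].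
    - by move=> t _; apply: measurableI; [exact: mE|exact: mts].
  rewrite -[leRHS]/(M%:E * Pr (E a))%E -Esum ge0_sume_distrr //.
  apply: lee_sum => t _.
  (* An empty event contributes 0; otherwise an outcome [x] in it shows that [t] minimizes [Y a], so
     [Y a t] is at most the average. *)
  have [->|/set0P[x [xa /= xt]]] := eqVneq (E a `&` [set o | ts o = t]) set0.
    by rewrite measure0 !mule0.
  apply: lee_wpmul2r => //; rewrite lee_fin.
  have YE (s : 'I_T.+1) : Y a s = X (pi^~ x) (pih^~ x) s by rewrite XY xa.
  rewrite -(ler_pM2l (ltr0Sn R T)); apply: le_trans avgY.
  have -> : T.+1%:R * Y a t = \sum_(s < T.+1) Y a t.
    by rewrite sumr_const card_ord mulr_natl.
  by apply: ler_sum => s _; have := amin x s; rewrite -xt !YE.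
(* Independence keeps the index uniform on each event [E a], so the row is exactly an average. *)
have Epr t : (Pr (E a `&` [set o | ts o = t]) = Pr (E a) * (T.+1%:R^-1)%:E)%E.
  by rewrite EE -(unif t); exact: indep.
have Efin : (Pr (E a) = (fine (Pr (E a)))%:E)%E by rewrite fineK // fin_num_measure.
under eq_bigr do rewrite Epr Efin -!EFinM.
rewrite Efin -EFinM sumEFin lee_fin -big_distrl /= mulrCA.
rewrite [leRHS]mulrC; apply: ler_wpM2l; first by rewrite fine_ge0.
by rewrite ler_pdivrMr ?ltr0Sn // mulrC.
Qed.

End RandomOutput.

(** * Choice of the constants and assembly of the rate *)

Lemma alg_local (R : realType) (n p q : nat) (P : minimax R n p q)
    (eta etah : nat -> R) (pi pi' pih pih' : nat -> 'S_n) w0 u0 t :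
  (forall k, (1 <= k <= t)%N -> pi k = pi' k /\ pih k = pih' k) ->
  alg P eta etah pi pih w0 u0 t = alg P eta etah pi' pih' w0 u0 t.
Proof.
elim: t => //= t IH h; rewrite IH => [|k /andP[k1 kt]].
  by have [-> ->] := h t.+1 (leqnn _).
by apply: h; rewrite k1 (leq_trans kt).
Qed.

Lemma absz_ceil_bounds (R : realType) (x : R) : 0 <= x ->
  x <= (absz (Num.ceil x))%:R <= x + 1.
Proof.
move=> x0; have c0 : 0 <= Num.ceil x by rewrite ceil_ge0; lra.
have -> : (absz (Num.ceil x))%:R = (Num.ceil x)%:~R :> R.
  by rewrite natr_absz ger0_norm.
by rewrite ceil_ge -lerBlDr -[1]/(1%:~R) -intrB ltW // ceilB1_lt.
Qed.

(** Initial gap and accumulated noise each take at most half of the target [m c eps^3 / 16]: the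
    first by the size of [m], the second by the choice of [c]. *)
Lemma average_arith (R : realType) (D B N c eps m S : R) :
  0 <= N -> D < B -> 0 < c -> c * (1 + 32 * N) = 1 -> 0 < eps -> 0 < m ->
  32 * B / c * eps ^- 3 <= m ->
  c * eps / 16 * S <= D + m * (N * (c * eps) ^+ 3) ->
  m^-1 * S <= eps ^+ 2.
Proof.
move=> N0 DB c0 cN e0 m0 hm hS.
rewrite ler_pdivrMl //.
have ce : 0 < c * eps / 16 by rewrite divr_gt0 // mulr_gt0.
rewrite -(ler_pM2l ce); apply: le_trans hS _.
have e3 : 0 < eps ^+ 3 by exact: exprn_gt0.
have hB : B <= m * (c * eps ^+ 3) / 32.
  have ce3 : 0 < c * eps ^+ 3 / 32 by rewrite divr_gt0 // mulr_gt0.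
  have := ler_wpM2l (ltW ce3) hm.
  have -> : c * eps ^+ 3 / 32 * (32 * B / c * eps ^- 3) = B.
    by field; rewrite !gt_eqF.
  by have -> : c * eps ^+ 3 / 32 * m = m * (c * eps ^+ 3) / 32 by ring.
have c1 : c <= 1 by have := mulr_ge0 (ltW c0) N0; move: cN; clear; lra.
have Nc : 32 * (N * c ^+ 2) <= 1.
  have : 0 <= (N * c) * (1 - c) by apply: mulr_ge0; [rewrite mulr_ge0 // ltW|lra].
  by move: cN c0; clear; lra.
have hN : m * (N * (c * eps) ^+ 3) <= m * (c * eps ^+ 3) / 32.
  have -> : m * (N * (c * eps) ^+ 3) = (N * c ^+ 2) * (m * (c * eps ^+ 3)) by ring.
  have mc : 0 <= m * (c * eps ^+ 3) by rewrite !mulr_ge0 // ltW.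
  have := ler_wpM2r mc Nc; clear; lra.
have -> : c * eps / 16 * (m * eps ^+ 2) = m * (c * eps ^+ 3) / 16 by ring.
by move: hB hN DB; clear; lra.
Qed.

Theorem theorem5 (R : realType)
  (Lw Lu Lf muH muh Thetaw sigmaw Thetau sigmau Lam0 Lam1 Lamh0 Lamh1 D0 D1 : R)
  (Lw_ge0 : 0 <= Lw) (Lu_ge0 : 0 <= Lu) (Lf_ge0 : 0 <= Lf)
  (muH_ge0 : 0 <= muH) (muh_ge0 : 0 <= muh) (mu_gt0 : 0 < muH + muh)
  (Thetaw_ge0 : 0 <= Thetaw) (sigmaw_ge0 : 0 <= sigmaw)
  (Thetau_ge0 : 0 <= Thetau) (sigmau_ge0 : 0 <= sigmau)
  (Lam0_ge1 : 1 <= Lam0) (Lam1_ge0 : 0 <= Lam1)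
  (Lamh0_ge1 : 1 <= Lamh0) (Lamh1_ge0 : 0 <= Lamh1) :
  exists c C K eps0 : R, [/\ 0 < c, 0 < C, 0 < K & 0 < eps0] /\
  forall (n p q : nat) (P : minimax R n p q) (w0 : 'rV[R]_p) (u0 : 'rV[R]_q),
  (0 < n)%N ->
  standing P Lw Lu muH muh Thetaw sigmaw Thetau sigmau ->
  domL P w0 u0 ->
  (Psi0 P w0 - Psi0star P)%E = D0%:E ->
  (Psi0 P w0 - Lagr P w0 u0)%E = D1%:E ->
  condC P Lf ->
  forall eps : R, 0 < eps < eps0 ->
  let kappa := Lu / (muH + muh) in
  let eta := c * eps in
  let etah := 30 * kappa ^+ 2 * eta in
  let T := absz (Num.ceil (C * eps ^- 3)) in
  let run := fun pi pih : nat -> 'S_n =>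
    alg P (fun=> eta) (fun=> etah) pi pih w0 u0 in
  let G := fun pi pih t => enorm (gradmap P eta (st_w (run pi pih t))) in
  condA P eta Lam0 Lam1 ->
  condB P etah Lamh0 Lamh1 ->
  (forall pi pih : nat -> 'S_n,
     T.+1%:R^-1 * \sum_(0 <= t < T.+1) G pi pih t ^+ 2 <= eps ^+ 2) /\
  (forall (d : measure_display) (Omega : measurableType d)
     (Pr : probability Omega R) (pi pih : nat -> Omega -> 'S_n)
     (ts : Omega -> 'I_T.+1),
     (forall k, discrete_rv (pi k)) -> (forall k, discrete_rv (pih k)) ->
     discrete_rv ts ->
     argmin_output (fun o => G (pi^~ o) (pih^~ o)) ts \/
     uniform_output Pr pi pih ts ->
     ('E_Pr[fun o => (G (pi^~ o) (pih^~ o) (ts o) ^+ 2)%R] <=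
        (eps ^+ 2)%:E)%E /\
     forall o,
       (st_nw (run (pi^~ o) (pih^~ o) T))%:R <= K * n%:R * eps ^- 3 /\
       (st_nu (run (pi^~ o) (pih^~ o) T))%:R <= K * n%:R * eps ^- 3).
Proof.
pose N := epoch_noise Lw Lu muH muh Thetaw sigmaw Thetau sigmau Lam0 Lam1 Lamh1.
pose Q := step_denom Lw Lu muH muh Thetaw sigmaw Thetau Lam0 Lam1 Lamh0.
have N0 : 0 <= N by exact: epoch_noise_ge0.
have Q1 : 1 <= Q by exact: step_denom_ge1.
(* [c] tames the noise and [C] the initial gap; the absolute values and the 1 in [B] keep [C]
   positive whatever the signs of [D0] and [D1]. *)
pose c := (1 + 32 * N)^-1; pose B := `|D0| + `|D1| + 1; pose C := 32 * B / c.
have c0 : 0 < c by rewrite invr_gt0; lra.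
have cN : c * (1 + 32 * N) = 1 by rewrite mulVf // gt_eqF //; lra.
have c1 : c <= 1 by rewrite invf_le1; lra.
have B0 : 1 <= B by rewrite lerDr addr_ge0.
have DB : D0 + D1 < B.
  by have := ler_norm D0; have := ler_norm D1; rewrite /B; lra.
have C0 : 0 < C by apply: divr_gt0 => //; lra.
(* [C + 1] absorbs the rounding up of [T]; [eps < Q^-1] yields both [eps <= 1] and the step size
   condition. *)
exists c, C, (C + 1), Q^-1; split.
  by split => //; [exact: addr_gt0|rewrite invr_gt0; lra].
move=> n p q P w0 u0 n0 hP [w0f u0h] hD0 hD1 _ eps /andP[e0 eQ].
move=> kappa eta etah T run G hA hB.
have eta0 : 0 < eta by exact: mulr_gt0.
have e1 : eps <= 1 by apply: le_trans (ltW eQ) _; rewrite invf_le1 //; lra.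
have etaQ : eta * Q <= 1.
  have Qp : 0 < Q by lra.
  rewrite -ler_pdivlMr // div1r; apply: le_trans (ltW eQ).
  by rewrite ger_pMl.
have ep3 : 0 < eps ^- 3 by rewrite invr_gt0 exprn_gt0.
have Ce0 : 0 <= C * eps ^- 3 by rewrite mulr_ge0 // ltW.
have /andP[T1 T2] := absz_ceil_bounds Ce0.
have avg pi pih :
    T.+1%:R^-1 * \sum_(0 <= t < T.+1) G pi pih t ^+ 2 <= eps ^+ 2.
  (* The sum includes the iterate at time [T], so the decrease is taken over [T.+1] epochs, one more
     than the algorithm runs. *)
  have [_ h] := gradmap_average n0 Lw_ge0 Lu_ge0 muH_ge0 muh_ge0 mu_gt0 hP
    Thetaw_ge0 Thetau_ge0 Lam0_ge1 Lam1_ge0 Lamh0_ge1 Lamh1_ge0 pi pih eta0 etaQ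
    w0f u0h hA hB T.+1 hD0 hD1.
  apply: (average_arith N0 DB c0 cN e0 _ _ h); first by rewrite ltr0n.
  by apply: le_trans T1 _; rewrite ler_nat.
split => [//|d Omega Pr pi pih ts mpi mpih mts out]; split.
  have G0 s sh t : 0 <= G s sh t by exact: enorm_ge0.
  have G20 s sh t : 0 <= G s sh t ^+ 2 by exact: sqr_ge0.
  have Gloc s s' sh sh' t : (forall k, (1 <= k <= t)%N -> s k = s' k /\ sh k = sh' k) ->
      G s sh t ^+ 2 = G s' sh' t ^+ 2.
    by move=> h; rewrite /G /run (alg_local _ _ _ _ _ h).
  have out2 : argmin_output (fun o t => G (pi^~ o) (pih^~ o) t ^+ 2) ts \/
      uniform_output Pr pi pih ts.
    case: out => [amin|unif]; [left|by right].
    by move=> o t; rewrite ler_pXn2r ?nnegrE ?G0 //; exact: amin.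
  clearbody G.
  exact: (@expectation_output R d Omega Pr n T _ (fun s sh t => G s sh t ^+ 2)
    pi pih ts G20 Gloc avg mpi mpih mts out2).
move=> o; have [-> ->] := run_counts P Lu muH muh eta (pi^~ o) (pih^~ o) w0 u0 T.
suff h : (T * n)%:R <= (C + 1) * n%:R * eps ^- 3 by split.
rewrite natrM mulrAC ler_pM2r ?ltr0n //; apply: le_trans T2 _.
rewrite mulrDl lerD2l mul1r -[leLHS]invr1 lef_pV2 ?posrE ?exprn_gt0 //.
by rewrite exprn_ile1 // ltW.
Qed.
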